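(* Let $p\ge 2$ be an integer such that $F_v(2,2,p;p+1)\le 2p+5$. Then $r'(p)=2$ and $$F_v(\underbrace{2,\dots,2}_{r},p;r+p-1)=F_v(2,2,p;p+1)+r-2\quad\text{for all } r\ge 2.$$
   Context: All graphs are finite, simple and undirected; $\omega(G)$ denotes the clique number. Write $G \overset{v}{\rightarrow} (a_1,\dots,a_s)$ if for every coloring of the vertices of $G$ with $s$ colors there exists $i$ such that $G$ contains a clique on $a_i$ vertices all of whose vertices have color $i$. $F_v(a_1,\dots,a_s;q)$ is the minimum number of vertices of a graph $G$ with $G \overset{v}{\rightarrow} (a_1,\dots,a_s)$ and $\omega(G)<q$. For fixed $p$, $r'(p)$ denotes the smallest integer $r_0\ge 2$ such that $\min_{r\ge 2}\{F_v(2_r,p;r+p-1)-r\}=F_v(2_{r_0},p;r_0+p-1)-r_0$, where $2_r$ denotes $r$ copies of $2$. *)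

(* Defs.v *)
From mathcomp Require Import all_boot.
From Stdlib Require Import ClassicalEpsilon.
From mathcomp Require Import ssrint ssralg ssrnum.

Set Implicit Arguments.
Unset Strict Implicit.
Unset Printing Implicit Defensive.

Definition simple_graph (n : nat) (E : rel 'I_n) : Prop :=
  irreflexive E /\ symmetric E.

Definition is_clique (n : nat) (E : rel 'I_n) (S : {set 'I_n}) : bool :=
  [forall x in S, forall y in S, (x != y) ==> E x y].

Definition clique_num_lt (n : nat) (E : rel 'I_n) (q : nat) : Prop :=
  forall S : {set 'I_n}, is_clique E S -> #|S| < q.

Definition vertex_arrows (n : nat) (E : rel 'I_n) (a : seq nat) : Prop :=
  forall c : 'I_n -> 'I_(size a),
    exists i : 'I_(size a), exists S : {set 'I_n},
      [/\ is_clique E S, #|S| = nth 0 a i & forall x, x \in S -> c x = i].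

Definition Fv_admissible (a : seq nat) (q n : nat) : Prop :=
  exists E : rel 'I_n, [/\ simple_graph E, vertex_arrows E a & clique_num_lt E q].

(* F_v(a; q): the minimum number of vertices of such a graph
   (defined by choice; unspecified if no such graph exists). *)
Definition Fv (a : seq nat) (q : nat) : nat :=
  epsilon (inhabits 0%N)
    (fun n => Fv_admissible a q n /\ forall m, Fv_admissible a q m -> n <= m).

Definition twos_p (r p : nat) : seq nat := nseq r 2 ++ [:: p].

Definition rp_val (p r : nat) : int :=
  ((Fv (twos_p r p) (r + p - 1))%:Z - r%:Z)%R.

Definition rprime (p : nat) : nat :=
  epsilon (inhabits 0%N)
    (fun r0 => [/\ 2 <= r0,
                   (forall r, 2 <= r -> (rp_val p r0 <= rp_val p r)%R)
                 & (forall r, 2 <= r -> r < r0 -> (rp_val p r0 < rp_val p r)%R)]).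

(* Main.v *)
(** The proof works in the complement [H] of [G]: a clique of [G] is a stable set
    of [H], and [G -> (2_r, p)] says that no [r] cliques of [H] can be removed so
    that the stability number drops below [p].

    Adding an isolated vertex to [H] gives [F(r + 1) <= F(r) + 1].  If the
    inequality were strict, an optimal [H] for [r + 1] would be robust: removing
    a clique never lowers its stability number [q].  Its order is at most
    [2 q + 3], whereas a minimal Hall obstruction (a stable set with too few
    neighbours) always yields an edge whose removal lowers the stability number.
    Iterating this contradicts [G -> (2_r, p)], except for triangle-free [H] of
    order exactly [2 q + 3].  There, removing one or two edges leaves a robust
    graph of order [2 b + 1] and stability number [b], which is an induced odd
    cycle by Hajnal's degree bound for critical graphs; the few vertices outside
    the cycle then close a shorter odd cycle whose complement is matched, which
    again lowers the stability number too much.  For [p = 2] the hypothesis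
    fails: a triangle-free graph on at most 9 vertices that is not 3-colourable
    would be 3-regular of order 9, which parity forbids. *)
Require Import Defs.
From mathcomp Require Import all_boot.
From mathcomp Require Import zify ssrint ssralg ssrnum order.
From Stdlib Require Import ClassicalEpsilon.
Set Implicit Arguments.
Unset Strict Implicit.
Unset Printing Implicit Defensive.

(** * Stable sets and tight sets *)

(* [lia] tries to unify cardinals up to conversion, which diverges on unrelated
   hypotheses about sets; only arithmetic facts are kept. *)
Ltac card_lia :=
  repeat match goal with
  | H := _ |- _ => clearbody H
  end;
  repeat match goal with
  | H : ?P |- _ =>
    lazymatch P with
    | is_true (leq _ _) => fail
    | is_true (~~ leq _ _) => fail
    | @eq nat _ _ => fail
    | _ => clear H
    end
  end; lia.

(** The count behind the argument. With [s = r + 2] and [a = p.-1], the assumption on [F 2] and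
    induction leave a robust graph for [s.+1] at most [2a + r + 7] vertices, and its stability
    number has to be brought from [a + r + 2] down to [a] by [r + 3] cliques: one clique more than
    the gain required, and by robustness the first one gains nothing. Once the stability number is
    at most [a + k] on at most [2a + k + 1] vertices, [k] cliques suffice, each losing at least one
    vertex. So many vertices have to be lost early; an isolated vertex costs a clique that loses
    only one, whence the interest in removals that isolate nothing. A triangle and an edge lose five
    vertices, exactly enough. Two edges lose four, one too few, so a triangle-free graph needs a
    third full edge. For [r > 0] a largest stable set still fills half of what one edge leaves; for
    [r = 0] this can fail by one vertex, and the analysis of odd cycles pays for that single
    vertex. *)

Section StableSets.
Variables (T : finType) (e : rel T).
Implicit Types (A B I K S W : {set T}) (x y : T).

Definition stable S := [forall x in S, forall y in S, ~~ e x y].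
Definition clq K := [forall x in K, forall y in K, (x != y) ==> e x y].
Definition alpha_le W a :=
  [forall S : {set T}, (stable S && (S \subset W)) ==> (#|S| <= a)].
Definition nb A W := [set y in W | [exists x in A, e x y]].
Definition drop k W a := exists Ks : seq {set T},
  [/\ size Ks = k, all clq Ks & alpha_le (foldl (@setD T) W Ks) a].

Lemma stableP S :
  reflect (forall x y, x \in S -> y \in S -> e x y = false) (stable S).
Proof.
apply: (iffP forall_inP) => [h x y xS yS|h x xS].
  by apply/negbTE; move/forall_inP: (h x xS); apply.
by apply/forall_inP => y yS; rewrite h.
Qed.

Lemma clqP K :
  reflect (forall x y, x \in K -> y \in K -> x != y -> e x y) (clq K).
Proof.
apply: (iffP forall_inP) => [h x y xS yS|h x xS].
  by move/forall_inP: (h x xS) => /(_ y yS)/implyP.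
by apply/forall_inP => y yS; apply/implyP; apply: h.
Qed.

Lemma alpha_leP W a :
  reflect (forall S, stable S -> S \subset W -> #|S| <= a) (alpha_le W a).
Proof.
apply: (iffP forallP) => [h S sS SW|h S]; first by have /implyP := h S; rewrite sS SW; apply.
by apply/implyP => /andP[]; apply: h.
Qed.

Lemma alpha_leNP W a :
  reflect (exists S, [/\ stable S, S \subset W & a < #|S|]) (~~ alpha_le W a).
Proof.
rewrite negb_forall; apply: (iffP existsP) => [[S]|[S [sS SW aS]]].
  by rewrite negb_imply -ltnNge => /andP[/andP[sS SW] aS]; exists S.
by exists S; rewrite negb_imply -ltnNge sS SW.
Qed.

Lemma alpha_leS W W' a a' :
  W' \subset W -> a <= a' -> alpha_le W a -> alpha_le W' a'.
Proof.
move=> sW la /alpha_leP h; apply/alpha_leP => S sS SW.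
by apply: leq_trans la; apply: h => //; apply: subset_trans sW.
Qed.

Lemma stableS S S' : S' \subset S -> stable S -> stable S'.
Proof.
by move=> /subsetP ss /stableP h; apply/stableP => x y /ss xS /ss yS; apply: h.
Qed.

Lemma nbP A W y : reflect (y \in W /\ exists2 x, x \in A & e x y) (y \in nb A W).
Proof.
rewrite inE; apply: (iffP andP) => [[yW /exists_inP[x xA exy]]|[yW [x xA exy]]].
  by split=> //; exists x.
by split=> //; apply/exists_inP; exists x.
Qed.

Lemma nb_sub A W : nb A W \subset W.
Proof. by apply/subsetP => y /nbP[]. Qed.

Lemma nbS A B W : A \subset B -> nb A W \subset nb B W.
Proof.
by move=> /subsetP s; apply/subsetP => y /nbP[yW [x /s xB exy]]; apply/nbP; split=> //; exists x.
Qed.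

Lemma nb1 x y W : (y \in nb [set x] W) = (y \in W) && e x y.
Proof.
apply/nbP/andP => [[yW [z]]|[yW exy]]; first by rewrite inE => /eqP->.
by split=> //; exists x; rewrite ?inE.
Qed.

Lemma nbD A W K : nb A (W :\: K) = nb A W :\: K.
Proof. by apply/setP => y; rewrite !inE andbA. Qed.

Lemma clq1 x : clq [set x].
Proof. by apply/clqP => y z; rewrite !inE => /eqP-> /eqP->; rewrite eqxx. Qed.

Lemma clq0 : clq set0.
Proof. by apply/clqP => y z; rewrite inE. Qed.

Hypothesis e_sym : symmetric e.
Hypothesis e_irr : irreflexive e.

Lemma clq2 x y : e x y -> clq [set x; y].
Proof.
move=> exy; apply/clqP => u v; rewrite !inE.
by move=> /orP[] /eqP-> /orP[] /eqP->; rewrite ?eqxx // e_sym.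
Qed.

Lemma edge_neq x y : e x y -> x != y.
Proof. by apply: contraTneq => ->; rewrite e_irr. Qed.

Lemma clq_stable K S : clq K -> stable S -> #|K :&: S| <= 1.
Proof.
move=> /clqP cK /stableP sS; rewrite leqNgt; apply/negP => /card_gt1P[x [y []]].
rewrite !inE => /andP[xK xS] /andP[yK yS] /(cK _ _ xK yK).
by rewrite sS.
Qed.

Lemma stableU1 x S :
  (forall y, y \in S -> ~~ e x y) -> stable S -> stable (x |: S).
Proof.
move=> h /stableP sS; apply/stableP => u v; rewrite !inE.
move=> /orP[/eqP->|uS] /orP[/eqP->|vS]; rewrite ?e_irr //; last exact: sS.
  exact/negbTE/h.
by rewrite e_sym; exact/negbTE/h.
Qed.

Lemma stable1 x : stable [set x].
Proof. by apply/stableP => y z; rewrite !inE => /eqP-> /eqP->; rewrite e_irr. Qed.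

Lemma clq_drop K W a : clq K -> alpha_le (W :\: K) a -> alpha_le W a.+1.
Proof.
move=> cK /alpha_leP h; apply/alpha_leP => S sS SW.
rewrite -(cardsID K S) -add1n setIC leq_add ?clq_stable //.
apply: h; last by rewrite setSD.
by apply: stableS sS; apply: subsetDl.
Qed.

Lemma stable_nb S W : S \subset W -> stable S -> #|nb S W| + #|S| <= #|W|.
Proof.
move=> SW /stableP sS; rewrite -(cardsID S W) (setIidPr SW) addnC leq_add2l.
apply: subset_leq_card; apply/subsetP => y /nbP[yW [x xS exy]].
by rewrite inE yW andbT; apply: contraL exy => yS; rewrite sS.
Qed.

(* A Hall obstruction of minimal size; [A] minimal makes every proper nonempty
   subset expand, which replaces the perfect matching given by Hall's theorem. *)
Definition tight A W := [&& stable A, A \subset W, A != set0 & #|nb A W| <= #|A|].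
Definition mintight A W := minset (fun B => tight B W) A.

Lemma mintightW A W : mintight A W -> tight A W.
Proof. by case/minsetP. Qed.

Lemma mintight_proper A W B :
  mintight A W -> B \proper A -> B != set0 -> #|B| < #|nb B W|.
Proof.
move=> mA pB B0; move: (mA) => /minsetP[/and4P[sA AW A0 _] minA].
rewrite ltnNge; apply: contraTN pB => tB.
have BA: B \subset A -> B = A.
  move=> sBA; apply: minA => //; apply/and4P; split=> //.
    exact: stableS sA.
  exact: subset_trans sBA AW.
by rewrite properE; apply/negP => /andP[/BA->]; rewrite subxx.
Qed.

Lemma tight_min A W : tight A W -> exists2 B, mintight B W & B \subset A.
Proof. by move=> tA; have [B mB sB] := @minset_exists _ (tight^~ W) A tA; exists B. Qed.

(** Exchange: a stable set [I] avoiding [x] and [y] becomes strictly larger when its part in the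
    neighbourhood of [A] is replaced by all of [A]. Minimality makes the part of [A] already in [I]
    expand, and [y] settles the case where that part is empty. *)
Lemma mintight_drop A W x y a :
  mintight A W -> x \in A -> y \in W -> e x y -> alpha_le W a.+1 ->
  alpha_le (W :\: [set x; y]) a.
Proof.
move=> mA xA yW exy /alpha_leP aW; have /and4P[sA AW A0 tA] := mintightW mA.
apply/alpha_leP => I sI IW.
have IW' : I \subset W := subset_trans IW (subsetDl _ _).
have xI : x \notin I by apply/negP => /(subsetP IW); rewrite !inE eqxx.
have yI : y \notin I by apply/negP => /(subsetP IW); rewrite !inE eqxx orbT.
have yN : y \in nb A W by apply/nbP; split=> //; exists x.
set N := nb A W in tA yN.
pose J := (I :\: N) :|: A.
have sJ : stable J.
  move/stableP: sA => sA; move/stableP: sI => sI.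
  have AI u v : u \in A -> v \in I :\: N -> e u v = false.
    rewrite inE => uA /andP[vN vI]; apply: contraNF vN => euv.
    by apply/nbP; split; [apply: (subsetP IW')|exists u].
  apply/stableP => u v; rewrite [u \in J]inE [v \in J]inE.
  move=> /orP[uI|uA] /orP[vI|vA]; [|by rewrite e_sym AI|by rewrite AI|exact: sA].
  by apply: sI; [case/setDP: uI|case/setDP: vI].
have JW : J \subset W by rewrite subUset AW andbT; apply: subset_trans (subsetDl _ _) IW'.
have := aW _ sJ JW.
suff : #|I| < #|J| by card_lia.
have -> : #|J| = #|(I :\: N) :\: A| + #|A|.
  rewrite /J -(cardsID A (_ :|: _)) setIUl setIid setDUl setDv setU0 addnC.
  by rewrite (setUidPr _) ?subsetIr.
have eqI : #|I| = #|(I :\: N) :\: A| + #|(I :\: N) :&: A| + #|I :&: N|.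
  by rewrite [X in X + _]addnC cardsID addnC cardsID.
suff : #|(I :\: N) :&: A| + #|I :&: N| < #|A| by card_lia.
set B := (I :\: N) :&: A.
have BA : B \proper A.
  rewrite properE subsetIr /=; apply/negP => /subsetP/(_ _ xA).
  by rewrite !inE (negbTE xI) andbF.
(* [B] lies in the stable set [I], so its neighbours miss [I]. Together with [y] they occupy more
   than [#|B|] of the at most [#|A|] vertices of [N]. *)
have dis : [disjoint nb B W :|: [set y] & I :&: N].
  rewrite -setI_eq0; apply/eqP/setP => z; rewrite inE [z \in set0]inE.
  apply/negP => /andP[]; rewrite !in_setU in_set1 in_setI => /orP[/nbP[zW [u uB euz]]|/eqP->].
    case/andP => zI _; have uI : u \in I by move: uB; rewrite !inE => /andP[/andP[]].
    by move/stableP: sI => /(_ u z uI zI); rewrite euz.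
  by rewrite (negbTE yI).
have sub : nb B W :|: [set y] :|: I :&: N \subset N.
  rewrite !subUset sub1set yN subsetIr !andbT; apply: nbS; exact: subsetIr.
have := subset_leq_card sub; rewrite cardsU (disjoint_setI0 dis) cards0 subn0.
have [B0|B0] := eqVneq B set0.
  have : 0 < #|nb B W :|: [set y]| by apply/card_gt0P; exists y; rewrite !inE eqxx orbT.
  rewrite B0 cards0; card_lia.
have := mintight_proper mA BA B0.
have := subset_leq_card (subsetUl (nb B W) [set y]); card_lia.
Qed.
End StableSets.

(** * Lowering the stability number by removing cliques *)

Section Drops.
Variables (T : finType) (e : rel T).
Hypothesis e_sym : symmetric e.
Hypothesis e_irr : irreflexive e.
Implicit Types (A B I K S W : {set T}) (x y : T).

Definition noiso W := forall x, x \in W -> exists2 y, y \in W & e x y.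
Definition edge_drop W a :=
  exists x y, [/\ x \in W, y \in W, e x y & alpha_le e (W :\: [set x; y]) a].

Lemma isolated_drop x W a :
  x \in W -> nb e [set x] W = set0 -> alpha_le e W a.+1 -> alpha_le e (W :\ x) a.
Proof.
move=> xW nx /alpha_leP h; apply/alpha_leP => I sI IW.
have xI : x \notin I by apply/negP => /(subsetP IW); rewrite !inE eqxx.
have IW' : I \subset W := subset_trans IW (subsetDl _ _).
have := h (x |: I); rewrite cardsU1 xI add1n ltnS; apply; last by rewrite subUset sub1set xW.
apply: stableU1 => // y /(subsetP IW') yW.
apply/negP => exy; have : y \in nb e [set x] W by rewrite nb1 yW.
by rewrite nx inE.
Qed.

Lemma tight_drop A W a :
  tight e A W -> alpha_le e W a.+1 ->
  exists K, [/\ clq e K, K \subset W, K != set0, #|K| <= 2 & alpha_le e (W :\: K) a].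
Proof.
move=> /tight_min[B mB _] aW; have /and4P[_ BW /set0Pn[x xB] _] := mintightW mB.
have xW := subsetP BW _ xB.
have [nx|/set0Pn[y]] := eqVneq (nb e [set x] W) set0.
  exists [set x]; split; rewrite ?clq1 ?sub1set ?cards1 //.
    by apply/set0Pn; exists x; rewrite inE.
  exact: isolated_drop.
rewrite nb1 => /andP[yW exy]; exists [set x; y]; split.
- exact: clq2.
- by rewrite subUset !sub1set xW.
- by apply/set0Pn; exists x; rewrite !inE eqxx.
- by rewrite cards2; card_lia.
- exact: (mintight_drop e_sym mB).
Qed.

Lemma tight_edge_drop A W a :
  tight e A W -> noiso W -> alpha_le e W a.+1 -> edge_drop W a.
Proof.
move=> /tight_min[B mB _] nW aW; have /and4P[_ BW /set0Pn[x xB] _] := mintightW mB.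
have [y yW exy] := nW _ (subsetP BW _ xB).
exists x, y; split=> //; first exact: (subsetP BW).
exact: (mintight_drop e_sym mB).
Qed.

Lemma card_tight S W :
  stable e S -> S \subset W -> S != set0 -> #|W| <= #|S|.*2 -> tight e S W.
Proof.
move=> sS SW S0 cW; apply/and4P; split=> //.
have := stable_nb SW sS; card_lia.
Qed.

(** A stable set of [a.+1] among at most [2a + 2] vertices is at least half of them, hence tight; if
    there is none, any vertex can be removed. The predecessor in [#|W|.-1] admits an empty [W]. *)
Lemma card_drop W a :
  #|W| <= a.*2.+2 -> alpha_le e W a.+1 ->
  exists K, [/\ clq e K, #|W :\: K| <= #|W|.-1 & alpha_le e (W :\: K) a].
Proof.
move=> cW aW; have [aW'|/alpha_leNP[S [sS SW aS]]] := boolP (alpha_le e W a).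
  have [->|/set0Pn[x xW]] := eqVneq W set0.
    exists set0; rewrite setD0; split; rewrite ?cards0 ?clq0 //.
    by apply: alpha_leS aW'; rewrite ?sub0set.
  exists [set x]; split; first exact: clq1.
    by have := cardsD1 x W; rewrite xW; card_lia.
  by apply: alpha_leS aW' => //; apply: subsetDl.
have tS : tight e S W.
  apply: card_tight => //; last card_lia.
  by rewrite -card_gt0; card_lia.
have [K [cK KW K0 _ aK]] := tight_drop tS aW.
exists K; split=> //; rewrite cardsD (setIidPr KW).
by move: K0; rewrite -card_gt0; card_lia.
Qed.

Lemma drop_cons K k W a : clq e K -> drop e k (W :\: K) a -> drop e k.+1 W a.
Proof.
by move=> cK [Ks [<- cKs aKs]]; exists (K :: Ks); split; rewrite //= cK.
Qed.

Lemma drop0 W a : alpha_le e W a -> drop e 0 W a.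
Proof. by exists [::]. Qed.

(** Each clique from [card_drop] lowers both the stability bound and the order by at least one, and
    its size condition persists because [2a + k + 1 <= 2a + 2k] for [k > 0]. *)
Lemma multi_drop k W a :
  alpha_le e W (a + k) -> #|W| <= a.*2 + k + 1 -> drop e k W a.
Proof.
elim: k W => [|k IHk] W; first by rewrite addn0 => aW _; apply: drop0.
rewrite addnS => aW cW.
have cW' : #|W| <= (a + k).*2.+2 by card_lia.
have [K [cK cWK aK]] := card_drop cW' aW.
by apply: (drop_cons cK); apply: IHk => //; card_lia.
Qed.

Lemma card_edge_drop W a :
  noiso W -> W != set0 -> #|W| <= a.*2.+2 -> alpha_le e W a.+1 -> edge_drop W a.
Proof.
move=> nW W0 cW aW; have [aW'|/alpha_leNP[S [sS SW aS]]] := boolP (alpha_le e W a).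
  have [x xW] := set0Pn _ W0; have [y yW exy] := nW x xW.
  by exists x, y; split=> //; apply: alpha_leS aW' => //; apply: subsetDl.
apply: (@tight_edge_drop S) => //; apply: card_tight => //; last card_lia.
by rewrite -card_gt0; card_lia.
Qed.

(** As [A] is minimal with at least two elements, each of its vertices has two neighbours. Removing
    [x] and a neighbour [y] keeps [A :\ x] tight, both sides losing a vertex, and a minimal tight
    set inside it still meets an edge, which lowers the stability number a second time. *)
Lemma mintight_drop2 A W a :
  mintight e A W -> 1 < #|A| -> alpha_le e W a.+2 ->
  exists x y, [/\ x \in W, y \in W, e x y & edge_drop (W :\: [set x; y]) a].
Proof.
move=> mA cA aW; have /and4P[sA AW /set0Pn[x xA] tA] := mintightW mA.
have prop1 z : z \in A -> 1 < #|nb e [set z] W|.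
  move=> zA; rewrite -(cards1 z); apply: (mintight_proper mA).
    by rewrite properEcard sub1set zA cards1.
  by rewrite -card_gt0 cards1.
have /card_gt0P[y] := ltnW (prop1 x xA); rewrite nb1 => /andP[yW exy].
exists x, y; split=> //; first exact: (subsetP AW).
set W' := W :\: [set x; y].
have yN : y \in nb e A W by apply/nbP; split=> //; exists x.
have yA : y \notin A.
  by apply/negP => yA; move/stableP: sA => /(_ x y xA yA); rewrite exy.
(* [x] is no neighbour of the stable set [A], so a neighbourhood can lose only [y]. *)
have nW' B : B \subset A -> #|nb e B W| <= #|nb e B W'|.+1.
  move=> BA; rewrite nbD cardsD.
  have : nb e B W :&: [set x; y] \subset [set y].
    apply/subsetP => z; rewrite !inE => /andP[/andP[zW /exists_inP[u uB euz]]].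
    case/orP=> // /eqP zx; move/stableP: sA => /(_ u x (subsetP BA _ uB) xA).
    by rewrite -zx euz.
  by move=> /subset_leq_card; rewrite cards1; have := subset_leq_card (subsetIl (nb e B W) [set x; y]); card_lia.
have tA' : tight e (A :\ x) W'.
  apply/and4P; split.
  - by apply: stableS sA; apply: subsetDl.
  - apply/subsetP => z; rewrite !inE => /andP[zx zA]; rewrite (subsetP AW) // (negbTE zx) /= andbT.
    by apply: contraNneq yA => <-.
  - by rewrite -card_gt0; have := cardsD1 x A; rewrite xA; card_lia.
  have := cardsD1 x A; rewrite xA.
  have := subset_leq_card (nbS e W' (subsetDl A [set x])).
  suff : #|nb e A W'| < #|nb e A W| by card_lia.
  rewrite nbD; apply: proper_card; rewrite properE subsetDl /=.
  by apply/negP => /subsetP/(_ y yN); rewrite !inE eqxx orbT.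
have [B mB sB] := tight_min tA'.
have /and4P[sB' BW' /set0Pn[x' x'B] tB] := mintightW mB.
have x'A : x' \in A by have := subsetP sB _ x'B; rewrite !inE => /andP[].
have : 0 < #|nb e [set x'] W'|.
  by have := prop1 x' x'A; have := nW' [set x']; rewrite sub1set x'A => /(_ isT); card_lia.
move=> /card_gt0P[y']; rewrite nb1 => /andP[y'W ey'].
exists x', y'; split=> //; first exact: (subsetP BW').
apply: (mintight_drop e_sym mB) => //.
exact: (mintight_drop e_sym mA).
Qed.
End Drops.

(** * Robust graphs *)

(** Used together with [alpha_le e W b.+1]: the stability number is then exactly [b.+1], and no
    clique lowers it. *)
Definition robust (T : finType) (e : rel T) (W : {set T}) b :=
  forall K, clq e K -> K \subset W -> ~~ alpha_le e (W :\: K) b.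

Section Robust.
Variables (T : finType) (e : rel T).
Hypothesis e_sym : symmetric e.
Hypothesis e_irr : irreflexive e.
Implicit Types (A B I K S W : {set T}) (x y : T).

Lemma robust_expand W b A :
  alpha_le e W b.+1 -> robust e W b ->
  stable e A -> A \subset W -> A != set0 -> #|A| < #|nb e A W|.
Proof.
move=> aW rW sA AW A0; rewrite ltnNge; apply/negP => tA.
have tt : tight e A W by apply/and4P.
have [K [cK KW _ _]] := tight_drop e_sym e_irr tt aW.
by rewrite (negbTE (rW _ cK KW)).
Qed.

Lemma robust_stable W b K : robust e W b -> clq e K -> K \subset W ->
  exists S, [/\ stable e S, S \subset W :\: K & b < #|S|].
Proof. by move=> rW cK KW; apply/alpha_leNP; apply: rW. Qed.

Lemma robust_deg W b x :
  alpha_le e W b.+1 -> robust e W b -> x \in W -> 1 < #|nb e [set x] W|.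
Proof.
move=> aW rW xW; rewrite -(cards1 x); apply: robust_expand aW rW _ _ _; rewrite ?stable1 ?sub1set //.
by apply/set0Pn; exists x; rewrite inE.
Qed.

End Robust.

(** * Robust graphs: removing a triangle, removing three disjoint edges *)

Section Whole.
Variables (T : finType) (e : rel T) (q : nat).
Hypothesis e_sym : symmetric e.
Hypothesis e_irr : irreflexive e.
Hypothesis aT : alpha_le e setT q.+2.
Hypothesis rT : robust e setT q.+1.
Implicit Types (A B I K S W : {set T}) (x y : T).

Lemma expandT A : stable e A -> A != set0 -> #|A| < #|nb e A setT|.
Proof. by move=> sA A0; apply: robust_expand aT rT _ _ _; rewrite ?subsetT. Qed.

Lemma degT x : 1 < #|nb e [set x] setT|.
Proof. exact: robust_deg aT rT _. Qed.

Lemma nbrsT x (P : {set T}) : (forall y, e x y -> y \in P) -> nb e [set x] setT \subset P.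
Proof. by move=> h; apply/subsetP => y; rewrite nb1 => /andP[_]; apply: h. Qed.

Lemma nbr_other x y : exists2 z, e x z & z != y.
Proof.
have /card_gt1P[u [v []]] := degT x; rewrite !nb1 !inE /= => xu xv uv.
have [uy|uy] := eqVneq u y; last by exists u.
by exists v => //; rewrite -uy eq_sym.
Qed.

Lemma stableT K : clq e K -> exists S, [/\ stable e S, [disjoint K & S] & q.+1 < #|S|].
Proof.
move=> cK; have [S [sS SK cS]] := robust_stable rT cK (subsetT K).
by exists S; split=> //; move: SK; rewrite subsetD => /andP[_]; rewrite disjoint_sym.
Qed.

(* Two isolated vertices of the complement of a triangle would have at most two
   common neighbours, against [expandT]. *)
Lemma noiso_twin a t t' :
  e a t -> e a t' -> e t t' -> (forall y, e a y -> y \in [set t; t']) ->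
  noiso e (setT :\: [set a; t; t']).
Proof.
move=> at_ at' tt' Na x; rewrite !inE !negb_or andbT => /andP[/andP[xa xt] xt'].
have [/existsP[y /andP[exy yn]]|] :=
    boolP [exists y, e x y && (y \notin [set a; t; t'])].
  by exists y => //; rewrite in_setD yn inE.
rewrite negb_exists => /forallP Nx.
have xNa : ~~ e x a.
  rewrite e_sym; apply/negP => /Na; rewrite !inE.
  by rewrite (negbTE xt) (negbTE xt').
have Nx' y : e x y -> y \in [set t; t'].
  move=> exy; have := Nx y; rewrite exy /= negbK !inE.
  by case/orP => [/orP[/eqP ya|->//]|->]; rewrite ?orbT //; rewrite -ya exy in xNa.
have sA : stable e [set x; a].
  apply: stableU1 => // [y|]; last exact: stable1.
  by rewrite inE => /eqP->.
have := expandT sA; rewrite cards2 xa => h.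
have : nb e [set x; a] setT \subset [set t; t'].
  apply/subsetP => y /nbP[_ [z]]; rewrite !in_set2 => /orP[]/eqP-> /=.
    by move/Nx'; rewrite !inE.
  by move/Na; rewrite !inE.
move/subset_leq_card; rewrite cards2.
have : [set x; a] != set0 by apply/set0Pn; exists x; rewrite !inE eqxx.
move=> /h; by case: (_ != _); lia.
Qed.

(** A vertex isolated by the removal has two or three neighbours on the triangle. With two, it forms
    a better triangle with them ([noiso_twin]); with three, it completes a clique of order four and
    could be added to a maximum stable set avoiding that clique. *)
Lemma triangle_noiso x y z : e x y -> e y z -> e x z ->
  exists u v w, [/\ e u v, e v w, e u w & noiso e (setT :\: [set u; v; w])].
Proof.
move=> xy yz xz.
have [/existsP[a /andP[]]|] := boolP [exists a, (a \notin [set x; y; z]) &&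
    [forall b, e a b ==> (b \in [set x; y; z])]]; last first.
  rewrite negb_exists => /forallP h; exists x, y, z; split=> // a.
  rewrite in_setD => /andP[an _]; have := h a; rewrite an /= negb_forall.
  by case/existsP => b; rewrite negb_imply => /andP[eab bn]; exists b => //; rewrite in_setD bn inE.
move=> an /forallP Na.
have {}Na b : e a b -> b \in [set x; y; z] by move=> eab; have := Na b; rewrite eab.
have yx : e y x by rewrite e_sym.
have zy : e z y by rewrite e_sym.
have zx : e z x by rewrite e_sym.
have deg := degT a.
have two t t' t'' : [set x; y; z] = [set t; t'; t''] -> ~~ e a t'' -> e t t' ->
  exists u v w, [/\ e u v, e v w, e u w & noiso e (setT :\: [set u; v; w])].
  move=> eqS at'' tt'.
  have Na' b : e a b -> b \in [set t; t'].
    move=> eab; have := Na b eab; rewrite eqS !inE => /orP[//|/eqP bt].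
    by rewrite -bt eab in at''.
  have sN := nbrsT Na'.
  have eN : nb e [set a] setT = [set t; t'].
    apply/eqP; rewrite eqEcard sN cards2; by case: (_ != _); lia.
  have at_ : e a t by have : t \in nb e [set a] setT; [rewrite eN !inE eqxx|rewrite nb1 => /andP[]].
  have at' : e a t' by have : t' \in nb e [set a] setT; [rewrite eN !inE eqxx orbT|rewrite nb1 => /andP[]].
  by exists a, t, t'; split=> //; apply: noiso_twin.
have [az|az] := boolP (e a z); last exact: (two x y z).
have [ay|ay] := boolP (e a y); last by apply: (two x z y) => //; apply/setP => i; rewrite !inE; do 3!case: (i == _).
have [ax|ax] := boolP (e a x); last by apply: (two y z x) => //; apply/setP => i; rewrite !inE; do 3!case: (i == _).
have cK : clq e [set a; x; y; z].
  apply/clqP => u v; rewrite !inE -!orbA.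
  by do 2![case/or4P => /eqP->]; rewrite ?eqxx // ?xy ?yz ?xz ?yx ?zx ?zy // e_sym.
have [S [sS dS cS]] := stableT cK.
have aS : a \notin S by rewrite (disjointFr dS) // !inE eqxx.
have /alpha_leP/(_ (a |: S)) := aT; rewrite subsetT cardsU1 aS => h.
suff /h/(_ isT) : stable e (a |: S) by card_lia.
apply: stableU1 => // b bS; apply/negP => /Na bN.
have : b \in [set a; x; y; z] by move: bN; rewrite !inE -!orbA => ->; rewrite orbT.
by move/(disjointFr dS); rewrite bS.
Qed.

Lemma noiso_neq0 W K : clq e K -> W = setT :\: K -> W != set0.
Proof.
move=> cK ->; have [S [sS SK cS]] := robust_stable rT cK (subsetT K).
by rewrite -card_gt0; apply: leq_trans (subset_leq_card SK); apply: leq_trans cS.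
Qed.

Lemma edge_drop_multi k K a W :
  clq e K -> edge_drop e (W :\: K) (a + k) -> #|W :\: K| <= a.*2 + k + 3 ->
  drop e k.+2 W a.
Proof.
move=> cK [x [y [xW yW exy aR]]] cW.
apply: (drop_cons cK); apply: (drop_cons (clq2 e_sym exy)); apply: multi_drop => //.
have : #|[set x; y]| = 2 by rewrite cards2 (edge_neq e_irr exy).
have : [set x; y] \subset W :\: K by rewrite subUset !sub1set xW.
by move=> /setIidPr s c; rewrite cardsD s c; card_lia.
Qed.

(** The triangle loses three vertices, the following edge two vertices and one unit of stability; at
    most [2a + r + 2 = 2a + (r + 1) + 1] vertices are left for [multi_drop] with [r + 1] cliques. *)
Lemma triangle_drop x y z r a :
  e x y -> e y z -> e x z -> q.+2 = a + r.+2 -> #|T| <= a.*2 + r + 7 ->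
  drop e r.+3 setT a.
Proof.
move=> xy yz xz qa nT.
have [u [v [w [uv vw uw nW]]]] := triangle_noiso xy yz xz.
have cK : clq e [set u; v; w].
  apply/clqP => s t; rewrite !inE -!orbA.
  by do 2![case/or3P => /eqP->]; rewrite ?eqxx // ?uv ?vw ?uw // e_sym.
have c3 : #|[set u; v; w]| = 3.
  rewrite setUC cardsU1 cards2 (edge_neq e_irr uv) !inE eq_sym (negbTE (edge_neq e_irr uw)).
  by rewrite eq_sym (negbTE (edge_neq e_irr vw)).
have cW : #|setT :\: [set u; v; w]| = #|T| - 3 by rewrite cardsD setTI cardsT c3.
apply: (edge_drop_multi cK); last by rewrite cW; card_lia.
apply: card_edge_drop => //.
- exact: noiso_neq0 cK _.
- by rewrite cW; card_lia.
by apply: alpha_leS aT; rewrite ?subsetT; card_lia.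
Qed.

Hypothesis tf : forall x y z, e x y -> e x z -> ~~ e y z.

Lemma noiso_edge u v : e u v -> noiso e (setT :\: [set u; v]).
Proof.
move=> uv x _; have /card_gt1P[y [z []]] := degT x; rewrite !nb1 !inE /= => xy xz yz.
have [yuv|yuv] := boolP (y \in [set u; v]); last by exists y => //; rewrite in_setD yuv inE.
exists z => //; rewrite in_setD in_setT andbT.
apply: contra (tf xy xz) => zuv; move: yuv zuv yz; rewrite !inE.
by do 2![case/orP => /eqP->]; rewrite ?eqxx // e_sym.
Qed.

Lemma card_edge u v W : e u v -> u \in W -> v \in W -> #|W :\: [set u; v]| = #|W| - 2.
Proof.
move=> uv uW vW; rewrite cardsD; congr (_ - _).
have /setIidPr-> : [set u; v] \subset W by rewrite subUset !sub1set uW.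
by rewrite cards2 (edge_neq e_irr uv).
Qed.

Lemma sparse_drop3 : #|T| <= q.*2 + 6 -> drop e 3 setT q.
Proof.
move=> nT; have [S [_ _ /(leq_trans (ltn0Sn _))/card_gt0P[u _]]] := stableT (clq0 e).
have [v uv _] := nbr_other u u.
have cW := card_edge uv (in_setT u) (in_setT v); rewrite cardsT in cW.
apply: (edge_drop_multi (clq2 e_sym uv)); last by rewrite cW; card_lia.
apply: card_edge_drop => //.
- exact: noiso_edge.
- exact: noiso_neq0 (clq2 e_sym uv) _.
- by rewrite cW; card_lia.
by apply: alpha_leS aT; rewrite ?subsetT ?addn1.
Qed.

Definition edge_drop3 := exists u v x y, [/\ e u v, x \in setT :\: [set u; v],
  y \in setT :\: [set u; v], e x y &
  edge_drop e (setT :\: [set u; v] :\: [set x; y]) q].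

(** [a], [x] and all their neighbours are among the six removed vertices, so both can be added to
    any stable set that remains. *)
Lemma pendant_drop3 a x p1 p2 p3 p4 p5 p6 :
  e p1 p2 -> e p3 p4 -> e p5 p6 -> uniq [:: p1; p2; p3; p4; p5; p6] ->
  a != x -> ~~ e a x ->
  a \in [:: p1; p2; p3; p4; p5; p6] -> x \in [:: p1; p2; p3; p4; p5; p6] ->
  (forall z, e a z -> z \in [:: p1; p2; p3; p4; p5; p6]) ->
  (forall z, e x z -> z \in [:: p1; p2; p3; p4; p5; p6]) ->
  edge_drop3.
Proof.
move=> e1 e2 e3 un ax eax aP xP Na Nx.
have un' := un; rewrite /= !inE !negb_or -!andbA in un'.
move/and5P: un' => [n1 n2 n3 n4 /and5P[n5 n6 n7 n8 /and5P[n9 n10 n11 n12 /and4P[n13 n14 n15 _]]]].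
exists p1, p2, p3, p4; split=> //.
- by rewrite !inE !negb_or ![_ == p1]eq_sym ![_ == p2]eq_sym n2 n6.
- by rewrite !inE !negb_or ![_ == p1]eq_sym ![_ == p2]eq_sym n3 n7.
exists p5, p6; split=> //.
- by rewrite !inE !negb_or ![_ == p1]eq_sym ![_ == p2]eq_sym ![_ == p3]eq_sym ![_ == p4]eq_sym; rewrite n4 n8 n11 n13.
- by rewrite !inE !negb_or ![_ == p1]eq_sym ![_ == p2]eq_sym ![_ == p3]eq_sym ![_ == p4]eq_sym; rewrite n5 n9 n12 n14.
apply/alpha_leP => I sI IW.
have nI z : z \in [:: p1; p2; p3; p4; p5; p6] -> z \notin I.
  move=> zP; apply/negP => /(subsetP IW); rewrite !inE.
  by move: zP; rewrite !inE => /or4P[->|->|->|/or3P[->|->|->]]; rewrite ?orbT ?andbF.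
have /alpha_leP/(_ (a |: (x |: I))) := aT; rewrite subsetT !cardsU1 !inE.
rewrite (negbTE ax) (negbTE (nI _ aP)) (negbTE (nI _ xP)) /= => h.
suff /h/(_ isT) : stable e (a |: (x |: I)) by card_lia.
apply: stableU1 => // [y|]; last apply: stableU1 => // y yI.
  rewrite !inE => /orP[/eqP-> //|yI].
  by apply/negP => /Na/nI; rewrite yI.
by apply/negP => /Nx/nI; rewrite yI.
Qed.

Definition closed_set (C : {set T}) := forall y z, y \in C -> e y z -> z \in C.

Hypothesis nE : ~ edge_drop3.

Lemma nbrs2 x s t :
  (forall z, e x z -> z \in [:: s; t]) -> e x s /\ e x t.
Proof.
move=> Nx; have sN : nb e [set x] setT \subset [set s; t].
  by apply: nbrsT => y /Nx; rewrite !inE.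
have eN : nb e [set x] setT = [set s; t].
  apply/eqP; rewrite eqEcard sN cards2; have := degT x; by case: (_ != _); lia.
split.
  by have : s \in nb e [set x] setT; [rewrite eN !inE eqxx|rewrite nb1 => /andP[]].
by have : t \in nb e [set x] setT; [rewrite eN !inE eqxx orbT|rewrite nb1 => /andP[]].
Qed.

Lemma no_twins a x u b : a != x -> ~~ e a x ->
  (forall z, e a z -> z \in [:: u; b]) -> (forall z, e x z -> z \in [:: u; b]) -> False.
Proof.
move=> ax eax Na Nx.
have sA : stable e [set a; x].
  by apply: stableU1 => // [y|]; [rewrite inE => /eqP->|apply: stable1].
have A0 : [set a; x] != set0 by apply/set0Pn; exists a; rewrite !inE eqxx.
have := expandT sA A0; rewrite cards2 ax.
have : nb e [set a; x] setT \subset [set u; b].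
  apply/subsetP => y /nbP[_ [z]]; rewrite !in_set2 => /orP[]/eqP->.
    by move/Na; rewrite !inE.
  by move/Nx; rewrite !inE.
by move/subset_leq_card; rewrite cards2; case: (_ != _); lia.
Qed.

(** Removing [uv] and [ab] lowers the stability number, as [a] extends every remaining stable set. A
    third edge would lower it again unless some [x] became isolated; such an [x] is joined to [v]
    and [b] only and closes the cycle [u v x b a]. A further neighbour [y] of [b], [u] or [v] would
    give [pendant_drop3] with the edge to [y]. *)
Lemma five_cycle_of_pendant u v a b :
  2 < q -> #|T| <= q.*2 + 6 -> e u v -> e a u -> e a b -> b != u -> a != v ->
  (forall z, e a z -> z \in [:: u; b]) ->
  exists Z : {set T}, [/\ u \in Z, closed_set Z, #|Z| = 5,
    (forall S, stable e S -> #|S :&: Z| <= 2) &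
    (forall C, closed_set C -> u \in C -> Z \subset C)].
Proof.
move=> q2 nT uv au ab bu nav Na.
have [ua ba vu] : [/\ e u a, e b a & e v u] by split; rewrite e_sym.
have [av ub] : ~~ e a v /\ ~~ e u b by split; [apply: tf uv|apply: tf ab].
have neq s t : e s t -> (s == t) = false by move=> /(edge_neq e_irr)/negbTE.
have av' : (v == a) = false by rewrite eq_sym (negbTE nav).
have bv : (b == v) = false by apply: contraNF ub => /eqP->.
pose W := setT :\: [set u; v]; pose R := W :\: [set a; b].
have aW : a \in W by rewrite !inE eq_sym (neq _ _ ua) eq_sym av'.
have bW : b \in W by rewrite !inE (negbTE bu) bv.
have cW : #|W| = #|T| - 2 by rewrite -cardsT card_edge ?inE.
have cR : #|R| = #|T| - 4 by rewrite /R card_edge // cW -subnDA.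
have aR : alpha_le e R q.+1.
  apply/alpha_leP => I sI IR.
  have nI z : z \in [:: u; b; a] -> z \notin I.
    move=> zP; apply/negP => /(subsetP IR); rewrite !inE.
    by move: zP; rewrite !inE => /or3P[->|->|->]; rewrite ?orbT ?andbF.
  have /alpha_leP/(_ (a |: I)) := aT; rewrite subsetT cardsU1 nI ?inE ?eqxx ?orbT // => h.
  suff /h/(_ isT) : stable e (a |: I) by [].
  apply: stableU1 => // y yI; apply/negP => /Na yN.
  have : y \notin I by apply: nI; move: yN; rewrite !inE => /orP[]->; rewrite ?orbT.
  by rewrite yI.
have [/existsP[x /andP[xR /forallP Nx]]|] :=
    boolP [exists x, (x \in R) && [forall y, e x y ==> (y \notin R)]]; last first.
  rewrite negb_exists => /forallP h; case: nE.
  exists u, v, a, b; split=> //; apply: card_edge_drop => //.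
  - move=> x xR; have := h x; rewrite xR /= negb_forall => /existsP[y].
    by rewrite negb_imply negbK => /andP[exy yR]; exists y.
  - have [S [sS dS cS]] := stableT (clq2 e_sym uv).
    rewrite -card_gt0 cR; have : S \subset W.
      by rewrite subsetD subsetT disjoint_sym.
    by move/subset_leq_card; rewrite cW; card_lia.
  - by rewrite cR; card_lia.
have {}Nx y : e x y -> y \in [:: u; v; a; b].
  move=> exy; have := Nx y; rewrite exy /= !inE !andbT negb_and !negbK.
  by case/orP=> /orP[]->; rewrite ?orbT.
have [xu xv xa xb] : [/\ x != u, x != v, x != a & x != b].
  by move: xR; rewrite !inE !negb_or andbT => /andP[/andP[? ?] /andP[? ?]].
have xa' : ~~ e x a.
  by rewrite e_sym; apply/negP => /Na; rewrite !inE (negbTE xu) (negbTE xb).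
have ax' : ~~ e a x by rewrite e_sym.
have ax : a != x by rewrite eq_sym.
have {}Nx y : e x y -> y \in [:: u; v; b].
  move=> exy; have := Nx y exy; rewrite !inE; case/or4P=> [->|->|/eqP ya|->]; rewrite ?orbT //.
  by rewrite -ya exy in xa'.
(* Joined to [u], the vertex [x] could not be joined to [v] without a triangle, and would be a twin
   of [a]. *)
have xu' : ~~ e x u.
  apply/negP => eu; have xnv := tf (_ : e u x) uv; apply: (@no_twins a x u b) => // y exy.
  have := Nx y exy; rewrite !inE; case/or3P => [->//|/eqP yv|->]; rewrite ?orbT //.
  by rewrite -yv exy in xnv; move: xnv; rewrite e_sym => /(_ eu).
have {}Nx y : e x y -> y \in [:: v; b].
  move=> exy; have := Nx y exy; rewrite !inE; case/or3P => [/eqP yu|->|->]; rewrite ?orbT //.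
  by rewrite -yu exy in xu'.
have [exv exb] := nbrs2 Nx.
have [vx bx] : e v x /\ e b x by rewrite ![e _ x]e_sym.
have vb : ~~ e v b by apply: tf exb.
have un : uniq [:: u; v; a; b; x].
  rewrite /= !inE !negb_or (edge_neq e_irr uv) (edge_neq e_irr ua) (eq_sym u b) bu.
  rewrite (eq_sym u x) xu av' (eq_sym v b) bv (eq_sym v x) xv (edge_neq e_irr ab) ax.
  by rewrite (eq_sym b x) xb.
have un6 w s : w \notin [:: u; v; a; b; x] -> s = [:: u; v; a; b; x] ->
   uniq (w :: s) by move=> wn ->; rewrite /= wn.
have Nb y : e b y -> y \in [:: a; x].
  move=> eby; apply/negPn/negP => yax; apply: nE.
  have yn : y \notin [:: u; v; a; b; x].
    move: yax; rewrite !inE !negb_or => /andP[-> ->]; rewrite !andbT /=.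
    apply/and3P; split; last by rewrite eq_sym (edge_neq e_irr eby).
    - by apply: contraNneq ub => <-; rewrite e_sym.
    by apply: contraNneq vb => <-; rewrite e_sym.
  apply: (@pendant_drop3 a x b y a u x v) => //.
  - rewrite (perm_uniq (_ : perm_eq _ [:: y; u; v; a; b; x])) ?(un6 y) //.
    by apply/permP => P /=; card_lia.
  - by rewrite !inE eqxx ?orbT.
  - by rewrite !inE eqxx ?orbT.
  - by move=> z /Na; rewrite !inE => /orP[]->; rewrite ?orbT.
  - by move=> z /Nx; rewrite !inE => /orP[]->; rewrite ?orbT.
have Nu y : e u y -> y \in [:: v; a].
  move=> euy; apply/negPn/negP => yax; apply: nE.
  have yn : y \notin [:: u; v; a; b; x].
    move: yax; rewrite !inE !negb_or => /andP[-> ->] /=.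
    apply/and3P; split; first by rewrite eq_sym (edge_neq e_irr euy).
    - by apply: contraNneq ub => <-.
    by rewrite e_sym in xu'; apply: contraNneq xu' => <-.
  apply: (@pendant_drop3 a x u y a b x v) => //.
  - rewrite (perm_uniq (_ : perm_eq _ [:: y; u; v; a; b; x])) ?(un6 y) //.
    by apply/permP => P /=; card_lia.
  - by rewrite !inE eqxx ?orbT.
  - by rewrite !inE eqxx ?orbT.
  - by move=> z /Na; rewrite !inE => /orP[]->; rewrite ?orbT.
  - by move=> z /Nx; rewrite !inE => /orP[]->; rewrite ?orbT.
have Nv y : e v y -> y \in [:: u; x].
  move=> evy; apply/negPn/negP => yax; apply: nE.
  have yn : y \notin [:: u; v; a; b; x].
    move: yax; rewrite !inE !negb_or => /andP[-> ->] /=; rewrite andbT.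
    apply/and3P; split; first by rewrite eq_sym (edge_neq e_irr evy).
    - by rewrite e_sym in av; apply: contraNneq av => <-.
    by apply: contraNneq vb => <-.
  apply: (@pendant_drop3 a x v y x b a u) => //.
  - rewrite (perm_uniq (_ : perm_eq _ [:: y; u; v; a; b; x])) ?(un6 y) //.
    by apply/permP => P /=; card_lia.
  - by rewrite !inE eqxx ?orbT.
  - by rewrite !inE eqxx ?orbT.
  - by move=> z /Na; rewrite !inE => /orP[]->; rewrite ?orbT.
  - by move=> z /Nx; rewrite !inE => /orP[]->; rewrite ?orbT.
exists [set z in [:: u; v; a; b; x]]; split.
- by rewrite !inE eqxx.
- move=> y z; rewrite !in_set ![y \in _]inE => /or4P[|||/orP[]] /eqP->.
  + by move/Nu; rewrite !inE => /orP[]->; rewrite ?orbT.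
  + by move/Nv; rewrite !inE => /orP[]->; rewrite ?orbT.
  + by move/Na; rewrite !inE => /orP[]->; rewrite ?orbT.
  + by move/Nb; rewrite !inE => /orP[]->; rewrite ?orbT.
  + by move/Nx; rewrite !inE => /orP[]->; rewrite ?orbT.
- by rewrite cardsE (card_uniqP un).
- move=> S sS; have c2 s t : e s t -> #|S :&: [set s; t]| <= 1.
    by move=> est; rewrite setIC; apply: clq_stable sS; apply: clq2.
  have sub s t w p : S :&: [set z in [:: u; v; a; b; x]] \subset S :&: [set s; t] :|: S :&: [set w; p] ->
     e s t -> e w p -> #|S :&: [set z in [:: u; v; a; b; x]]| <= 2.
    move=> /subset_leq_card h /c2 h1 /c2 h2; apply: leq_trans h _.
    by apply: leq_trans (leq_card_setU _ _) _; rewrite -[2]/(1 + 1) leq_add.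
  (* Two disjoint edges cover the cycle up to one vertex, chosen outside [S]. *)
  have [uS|uS] := boolP (u \in S).
    have vS : v \notin S by apply: contraTN uv => vS; move/stableP: sS => ->.
    have aS : a \notin S by apply: contraTN ua => aS; move/stableP: sS => ->.
    apply: (sub u v x b) => //; apply/subsetP => z; rewrite !inE => /andP[zS].
    rewrite zS => /or4P[->|->|/eqP za|/orP[]->]; rewrite ?orbT //.
    by rewrite za (negbTE aS) in zS.
  apply: (sub a b v x) => //; first apply/subsetP => z; rewrite ?inE //.
  case/andP => zS; rewrite zS => /or4P[/eqP zu|->|->|/orP[]->]; rewrite ?orbT //.
  by rewrite zu (negbTE uS) in zS.
move=> C cC uC; have vC := cC _ _ uC uv; have aC := cC _ _ uC ua.
have bC := cC _ _ aC ab; have xC := cC _ _ vC vx.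
by apply/subsetP => z; rewrite !inE => /or4P[|||/orP[]] /eqP->.
Qed.

(** After removal of an edge [uv] a largest stable set is tight. A minimal tight set with two
    elements would give two further edges by [mintight_drop2], so it is a single vertex [a] with one
    neighbour [b] left and another one in [uv]. *)
Lemma five_cycle u :
  2 < q -> #|T| <= q.*2 + 6 ->
  exists Z : {set T}, [/\ u \in Z, closed_set Z, #|Z| = 5,
    (forall S, stable e S -> #|S :&: Z| <= 2) &
    (forall C, closed_set C -> u \in C -> Z \subset C)].
Proof.
move=> q2 nT; have [v uv _] := nbr_other u u.
have [S [sS dS cS]] := stableT (clq2 e_sym uv).
pose W := setT :\: [set u; v].
have SW : S \subset W by rewrite subsetD subsetT disjoint_sym.
have cW : #|W| = #|T| - 2 by rewrite -cardsT card_edge ?inE.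
have tS : tight e S W.
  apply: card_tight => //; first by rewrite -card_gt0; card_lia.
  by rewrite cW; card_lia.
have [A mA _] := tight_min tS.
have aW : alpha_le e W q.+2 by apply: alpha_leS aT; rewrite ?subsetT.
have [cA|cA] := ltnP 1 #|A|.
  have [x [y [xW yW exy h]]] := mintight_drop2 e_sym mA cA aW.
  by case: nE; exists u, v, x, y.
have /and4P[_ AW A0 tA] := mintightW mA.
have /eqP/cards1P[a eA] : #|A| = 1 by move: A0; rewrite -card_gt0; card_lia.
rewrite eA cards1 in tA.
have aW' : a \in W by apply: (subsetP AW); rewrite eA inE.
have [b bW ab] := noiso_edge uv aW'.
have Nb z : e a z -> z \in W -> z = b.
  move=> az zW; apply: (card_le1_eqP tA); by rewrite nb1 ?zW ?bW.
have [z az zb] := nbr_other a b.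
have zuv : z \in [set u; v].
  apply: contraNT zb => zn; apply/eqP/Nb => //; by rewrite in_setD zn inE.
have Na s t : [set u; v] = [set s; t] -> e a s -> e s t -> forall z, e a z -> z \in [:: s; b].
  move=> E as_ st y ay; rewrite !inE.
  have [yW|] := boolP (y \in W); first by rewrite (Nb y) ?eqxx ?orbT.
  rewrite in_setD in_setT andbT negbK E !inE => /orP[->//|/eqP yt].
  by have := tf as_ ay; rewrite yt st.
have bn s : s \in [set u; v] -> b != s.
  by apply: contraTneq => <-; move: bW; rewrite in_setD => /andP[].
move: zuv; rewrite !inE => /orP[]/eqP zE; rewrite zE in az.
  apply: (@five_cycle_of_pendant u v a b) => //; last exact: (Na u v).
    by apply: bn; rewrite !inE eqxx.
  by apply: contraTneq aW' => ->; rewrite !inE eqxx orbT.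
have vu : e v u by rewrite e_sym.
have [|||Z [vZ cZ c5 aZ mZ]] := @five_cycle_of_pendant v u a b q2 nT vu az ab.
- by apply: bn; rewrite !inE eqxx orbT.
- by apply: contraTneq aW' => ->; rewrite !inE eqxx.
- by apply: (Na v u) => //; rewrite setUC.
exists Z; split=> //; first exact: cZ vu.
by move=> C cC /cC/(_ uv); apply: mZ.
Qed.

(** Every component is a pentagon. Outside two of them at most [2q - 4] vertices remain, and a
    maximum stable set keeps at least [q + 2 - 4] of these, a nonempty set that is half of them and
    so cannot expand. *)
Lemma no_edge_drop3 : 2 < q -> #|T| <= q.*2 + 6 -> False.
Proof.
move=> q2 nT; have [S [sS _ cS]] := stableT (clq0 e).
have S0 : S != set0 by rewrite -card_gt0; card_lia.
have /set0Pn[u _] := S0.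
have [Z [uZ cZ c5 aZ _]] := five_cycle u q2 nT.
have cT : (q.+2).*2 < #|T|.
  have := expandT sS S0; have := stable_nb (subsetT S) sS; rewrite cardsT; card_lia.
have /card_gt0P[w] : 0 < #|~: Z| by have := cardsC Z; card_lia.
rewrite inE => wZ.
have [Z' [wZ' cZ' c5' aZ' mZ']] := five_cycle w q2 nT.
have cC : closed_set (~: Z).
  by move=> y z; rewrite !inE e_sym => yZ ezy; apply: contra yZ => zZ; apply: cZ ezy.
have dZ : Z' \subset ~: Z by apply: mZ' => //; rewrite inE.
pose U := ~: (Z :|: Z').
have cU : #|U| = #|T| - 10.
  have := cardsC (Z :|: Z'); rewrite cardsU disjoint_setI0 ?cards0; first by rewrite -/U; card_lia.
  by rewrite disjoint_sym disjoints_subset.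
pose A := S :&: U.
have cA : #|S| <= #|A| + 4.
  have := subset_leq_card (_ : S \subset A :|: (S :&: Z :|: S :&: Z')) => h.
  have {}h : #|S| <= #|A :|: (S :&: Z :|: S :&: Z')|.
    by apply: h; apply/subsetP => y yS; rewrite !inE yS /=; case: (y \in Z); case: (y \in Z').
  apply: leq_trans h _; apply: leq_trans (leq_card_setU _ _) _; rewrite leq_add2l.
  apply: leq_trans (leq_card_setU _ _) _; rewrite -[4]/(2 + 2) leq_add ?aZ ?aZ' //.
have sA : stable e A by apply: stableS sS; apply: subsetIl.
have A0 : A != set0 by rewrite -card_gt0; card_lia.
have nU : nb e A setT = nb e A U.
  apply/setP => y; apply/nbP/nbP => -[_ [z zA ezy]]; split; rewrite ?in_setT //; try by exists z.
  move: zA; rewrite !inE !negb_or => /and3P[_ zZ zZ']; rewrite e_sym in ezy.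
  apply/andP; split; first by apply: contra zZ => yZ; apply: cZ ezy.
  by apply: contra zZ' => yZ; apply: cZ' ezy.
have h1 := expandT sA A0; rewrite nU in h1.
have AU : A \subset U := subsetIr S U.
have h2 := stable_nb AU sA; rewrite cU in h2.
card_lia.
Qed.
End Whole.

(** * Critical subgraphs and odd cycles *)

Section Arcs.
Variable f : nat -> bool.
Hypothesis f_adj : forall i, ~~ (f i && f i.+1).

Lemma even_arc m j : \sum_(j <= i < j + m.*2) f i <= m.
Proof.
elim: m j => [|m IHm] j; first by rewrite addn0 big_geq.
have lt1 : j < j + m.+1.*2 by rewrite -[X in X < _]addn0 ltn_add2l.
have lt2 : j.+1 < j + m.+1.*2 by rewrite -addn1 ltn_add2l.
rewrite big_ltn // big_ltn // addnA.
have -> : j + m.+1.*2 = j.+2 + m.*2 by rewrite doubleS !addnS !addSn.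
rewrite -[X in _ <= X]add1n leq_add ?IHm //.
by have := f_adj j; case: (f j); case: (f j.+1).
Qed.

Lemma odd_arc m j : \sum_(j <= i < (j + m.*2).+1) f i <= m + (f j && f (j + m.*2)).
Proof.
have [fj|fj] := boolP (f j); last first.
  by rewrite big_ltn ?ltnS ?leq_addr // (negbTE fj) add0n addn0 -addSn even_arc.
by rewrite big_nat_recr ?leq_addr //= leq_add2r even_arc.
Qed.

Lemma shift_window L j : (forall i, f (i + L) = f i) ->
  \sum_(j <= i < j + L) f i = \sum_(0 <= i < L) f i.
Proof.
move=> fL; elim: j => [|j <-]; first by rewrite add0n.
have [->|L0] := posnP L; first by rewrite !addn0 !big_geq.
rewrite [RHS]big_ltn; last by rewrite -[X in X < _]addn0 ltn_add2l.
rewrite addSn big_nat_recr /= ?fL 1?addnC //.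
by rewrite addnC -addn1 leq_add2l.
Qed.
End Arcs.

Section Critical.
Variables (T : finType) (e : rel T).
Hypothesis e_sym : symmetric e.
Hypothesis e_irr : irreflexive e.
Implicit Types (A B I K S W : {set T}) (x y : T).

Lemma stable_sub (d : rel T) S : subrel d e -> stable e S -> stable d S.
Proof.
by move=> de /stableP h; apply/stableP => x y xS yS; apply: contraFF (h x y xS yS); apply: de.
Qed.

Lemma alpha_le_sub (d : rel T) W a : subrel d e -> alpha_le d W a -> alpha_le e W a.
Proof.
by move=> de /alpha_leP h; apply/alpha_leP => S /(stable_sub de); apply: h.
Qed.

Lemma robust_sub (d : rel T) W a : subrel d e -> robust e W a -> robust d W a.
Proof.
move=> de rW K cK KW; apply: contra (alpha_le_sub de) _; apply: rW => //.
by move/clqP: cK => cK; apply/clqP => x y xK yK xy; apply: de; apply: cK.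
Qed.

(** A minimal edge set keeping the stability number at most [a]: deleting one more edge creates a
    stable set [J] larger than [a], whose only edge was that one. Edges are ordered pairs
    symmetrized by [r], so both orders are deleted together. *)
Lemma critical_subgraph W a : alpha_le e W a ->
  exists d : rel T, [/\ symmetric d, subrel d e, alpha_le d W a &
    forall x y, d x y -> exists J : {set T}, [/\ J \subset W, a < #|J| &
      forall u v, u \in J -> v \in J -> d u v ->
        (u == x) && (v == y) || (u == y) && (v == x)]].
Proof.
move=> aW; pose r (D : {set T * T}) : rel T := fun x y => ((x, y) \in D) || ((y, x) \in D).
pose E := [set p : T * T | e p.1 p.2].
pose P (D : {set T * T}) := (D \subset E) && alpha_le (r D) W a.
have rE : r E =2 e by move=> x y; rewrite /r !inE /= [e y x]e_sym orbb.
have PE : P E.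
  rewrite /P subxx; apply/alpha_leP => S /stableP sS SW; move/alpha_leP: aW; apply => //.
  by apply/stableP => x y xS yS; rewrite -rE sS.
have [D /minsetP[/andP[DE aD] mD] _] := @minset_exists _ P E PE.
have de : subrel (r D) e.
  by move=> x y /orP[] /(subsetP DE); rewrite inE //= e_sym.
exists (r D); split=> // [x y|x y dxy]; first by rewrite /r orbC.
pose D' := D :\: [set (x, y); (y, x)].
have D'D : D' \subset D by apply: subsetDl.
have : ~~ alpha_le (r D') W a.
  apply/negP => aD'; have : D' = D by apply: mD => //; rewrite /P aD' (subset_trans D'D DE).
  by move=> eD; move: dxy; rewrite /r -eD !inE !eqxx ?orbT.
case/alpha_leNP => J [/stableP sJ JW cJ]; exists J; split=> // u v uJ vJ.
have := sJ u v uJ vJ; rewrite /r !inE !xpair_eqE.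
move=> h; apply: contraLR => n; rewrite negb_or.
move: h; rewrite negb_or in n; case/andP: n => n1 n2.
by rewrite [(v == x) && _]andbC [(v == y) && _]andbC (negbTE n1) (negbTE n2) /= => /negbT; rewrite negb_or.
Qed.
End Critical.

(** * Critical robust graphs of order [2b + 3] are 2-regular *)

Section Hajnal.
Variables (T : finType) (d : rel T) (W : {set T}) (b : nat).
Hypothesis d_sym : symmetric d.
Hypothesis d_irr : irreflexive d.
Hypothesis aW : alpha_le d W b.+1.
Hypothesis rW : robust d W b.
Hypothesis cW : #|W| = b.*2 + 3.
Hypothesis crit : forall x y, d x y -> exists J : {set T},
  [/\ J \subset W, b.+1 < #|J| &
      forall u v, u \in J -> v \in J -> d u v ->
        (u == x) && (v == y) || (u == y) && (v == x)].
Implicit Types (A I K R S : {set T}) (x y : T).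

(** The set [J] that becomes stable without the edge contains both its ends; [J] minus [t] is a
    maximum stable set in which [x] is the only neighbour of [t]. *)
Lemma critical_edge x t : d x t -> exists R,
  [/\ stable d R, R \subset W, #|R| = b.+1, x \in R &
      forall y, y \in R -> d t y -> y = x] /\ t \notin R.
Proof.
move=> xt; have [J [JW cJ hJ]] := crit xt.
have nxt : x != t := edge_neq d_irr xt.
have : ~~ stable d J.
  by apply/negP => sJ; move/alpha_leP: aW => /(_ J sJ JW); card_lia.
move=> nJ; have {nJ} [u [v [uJ vJ uv]]] : exists u v, [/\ u \in J, v \in J & d u v].
  move: nJ; rewrite negb_forall => /existsP[u]; rewrite negb_imply => /andP[uJ].
  rewrite negb_forall => /existsP[v]; rewrite negb_imply negbK => /andP[vJ uv].
  by exists u, v.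
have [xJ tJ] : x \in J /\ t \in J.
  by have := hJ u v uJ vJ uv; case/orP => /andP[/eqP<- /eqP<-].
have sR : stable d (J :\ t).
  apply/stableP => y z; rewrite !inE => /andP[yt yJ] /andP[zt zJ].
  apply/negP => yz; have := hJ _ _ yJ zJ yz.
  by rewrite (negbTE yt) (negbTE zt) andbF.
have RW : J :\ t \subset W := subset_trans (subsetDl _ _) JW.
exists (J :\ t); split; last by rewrite !inE eqxx.
split=> //; last 2 first.
- by rewrite !inE nxt.
- move=> y; rewrite !inE => /andP[yt yJ] ty.
  have := hJ _ _ tJ yJ ty; rewrite (negbTE yt) andbF eqxx /=.
  by move=> /eqP.
move/alpha_leP: aW => /(_ _ sR RW).
have := cardsD1 t J; rewrite tJ; card_lia.
Qed.

(* Hajnal's bound on the degrees of a critical graph: three edges at [x] would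
   give maximum stable sets [R i] whose union and intersection are too large. *)
Lemma critical_degree x : x \in W -> #|nb d [set x] W| = 2.
Proof.
move=> xW; have := robust_deg d_sym d_irr aW rW xW.
rewrite leq_eqVlt => /orP[/eqP<-//|/card_gt2P[t1 [t2 [t3 []]]]].
rewrite !nb1 => -[/andP[t1W xt1] /andP[t2W xt2] /andP[t3W xt3]] [n12 n23 n31].
have [R1 [[s1 W1 c1 x1 h1] tR1]] := critical_edge xt1.
have [R2 [[s2 W2 c2 x2 h2] tR2]] := critical_edge xt2.
have [R3 [[s3 W3 c3 x3 h3] tR3]] := critical_edge xt3.
exfalso.
pose U := R1 :|: R2; pose A := R1 :&: R2.
(* These are the vertices lying in at least two of the three sets, and any two such vertices share
   one of the sets. *)
have sUA : stable d (R3 :&: U :|: A).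
  move/stableP: s1 => s1; move/stableP: s2 => s2; move/stableP: s3 => s3.
  apply/stableP => u v; rewrite !inE => /orP[/andP[u3 u12]|/andP[u1 u2]] /orP[/andP[v3 v12]|/andP[v1 v2]].
  - exact: s3.
  - by case/orP: u12 => u12; [apply: s1|apply: s2].
  - by case/orP: v12 => v12; [apply: s1|apply: s2].
  - exact: s1.
have UW : U \subset W by rewrite subUset W1.
have AU : A \subset U by apply: subset_trans (subsetIl _ _) (subsetUl _ _).
have hUA : #|R3 :&: U :|: A| <= b.+1.
  move/alpha_leP: aW; apply=> //; rewrite subUset (subset_trans AU UW) andbT.
  by apply: subset_trans W3; apply: subsetIl.
pose V := U :|: R3; pose B := A :&: R3.
(* Counted with multiplicity, the three sets have the total size of [V], [B] and the stable set
   above, and that set has at most [b.+1] elements. *)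
have cVB : b.+1.*2 <= #|V| + #|B|.
  have e1 : #|R3 :&: U :|: A| = #|R3 :&: U| + #|A :\: R3|.
    rewrite cardsU -(cardsID R3 A).
    have -> : R3 :&: U :&: A = A :&: R3.
      by rewrite -setIA (setIidPr AU) setIC.
    by have := subset_leq_card (subsetIr A R3); card_lia.
  have e2 := cardsUI R1 R2; have e3 := cardsUI U R3; have e4 := cardsID R3 A.
  rewrite c1 c2 -/U -/A in e2; rewrite c3 -/V in e3.
  rewrite [U :&: R3]setIC in e3; rewrite -/B in e4; rewrite e1 in hUA.
  by clear -e2 e3 e4 hUA; move: e2 e3 e4 hUA; card_lia.
have xV : x \in V by rewrite !inE x1.
have tV t : t \in [set t1; t2; t3] -> t \notin V.
  have xt : t \in [set t1; t2; t3] -> d x t by rewrite !inE -orbA => /or3P[]/eqP->.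
  move=> /xt dxt; rewrite !inE !negb_or -andbA; apply/and3P.
  by split; apply: contraL dxt => tR; [move/stableP: s1 => ->|move/stableP: s2 => ->|move/stableP: s3 => ->].
pose C := B :\ x.
have BC : #|B| = #|C|.+1 by rewrite (cardsD1 x B) !inE x1 x2 x3.
have sC : stable d C by apply: stableS s1; apply/subsetP => y; rewrite !inE => /and3P[_ /andP[]].
have CW : C \subset W by apply: subset_trans W1; apply/subsetP => y; rewrite !inE => /and3P[_ /andP[]].
have nC : #|C| <= #|nb d C W|.
  by have [->|C0] := eqVneq C set0; rewrite ?cards0 //; apply: ltnW; apply: robust_expand aW rW _ _ _.
(* A vertex of [C] lies in all three sets and differs from [x], so it has no neighbour in [V] nor
   among the [t]. The disjoint parts would then need [2b + 4] vertices of [W]. *)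
have dis : [disjoint nb d C W & V :|: [set t1; t2; t3]].
  rewrite -setI_eq0; apply/eqP/setP => y; rewrite [y \in set0]inE inE; apply/negP.
  case/andP => /nbP[yW [z]]; rewrite !in_setD1 !in_setI => /andP[zx /andP[/andP[z1 z2] z3]] zy.
  rewrite !inE -!orbA => /or4P[yR|yR|yR|].
  - by move/stableP: s1 => /(_ z y z1 yR); rewrite zy.
  - by move/stableP: s2 => /(_ z y z2 yR); rewrite zy.
  - by move/stableP: s3 => /(_ z y z3 yR); rewrite zy.
  move=> yt; case/negP: zx; move: yt zy => /or3P[] /eqP->; rewrite d_sym => zt; apply/eqP.
  - exact: h1 z1 zt.
  - exact: h2 z2 zt.
  exact: h3 z3 zt.
have c3t : #|[set t1; t2; t3]| = 3.
  by rewrite setUC cardsU1 cards2 !inE negb_or n12 n31 eq_sym n23.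
have dV : [disjoint V & [set t1; t2; t3]].
  by rewrite disjoint_sym disjoints_subset; apply/subsetP => t /tV; rewrite in_setC.
have cU1 : #|V :|: [set t1; t2; t3]| = #|V| + 3.
  by rewrite cardsU (disjoint_setI0 dV) cards0 subn0 c3t.
have : nb d C W :|: (V :|: [set t1; t2; t3]) \subset W.
  rewrite !subUset nb_sub W1 W2 W3 !sub1set /=.
  by rewrite t1W t2W t3W.
move/subset_leq_card; rewrite cardsU (disjoint_setI0 dis) cards0 subn0 cU1 cW.
by clear -cVB BC nC; card_lia.
Qed.
End Hajnal.

(** * A cycle in a 2-regular graph *)

Section TwoRegular.
Variables (T : finType) (d : rel T) (W : {set T}).
Hypothesis d_sym : symmetric d.
Hypothesis d_irr : irreflexive d.
Hypothesis deg : forall x, x \in W -> #|nb d [set x] W| = 2.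
Implicit Types (x y : T).

Lemma two_nbrs x y1 y2 y : x \in W -> y1 \in W -> y2 \in W -> y \in W ->
  d x y1 -> d x y2 -> d x y -> y1 != y2 -> y = y1 \/ y = y2.
Proof.
move=> xW y1W y2W yW d1 d2 dy n12.
have : nb d [set x] W = [set y1; y2].
  apply/eqP; rewrite eq_sym eqEcard deg // cards2 n12 andbT subUset !sub1set !nb1.
  by rewrite y1W y2W d1.
move/setP/(_ y); rewrite nb1 yW dy !inE => /esym/orP[]/eqP; auto.
Qed.

Lemma other_nbr x y : x \in W -> exists z, [/\ z \in W, d x z & z != y].
Proof.
move=> xW; have /card_gt1P[u [v []]] : 1 < #|nb d [set x] W| by rewrite deg.
rewrite !nb1 => /andP[uW xu] /andP[vW xv] uv.
have [uy|uy] := eqVneq u y; last by exists u.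
by exists v; split=> //; rewrite -uy eq_sym.
Qed.

Lemma longest_path : W != set0 -> exists2 s : seq T,
  [&& uniq s, all (mem W) s, sorted d s & s != [::]] &
  forall y, y \in W -> d (head y s) y -> y \in s.
Proof.
case/set0Pn => x xW.
pose P n := [exists s : n.-tuple T, [&& uniq s, all (mem W) s & sorted d s]].
have P1 : P 1 by apply/existsP; exists [tuple x]; rewrite /= xW.
have Pm n : P n -> n <= #|T|.
  case/existsP => s /andP[us _]; rewrite -(size_tuple s) -(card_uniqP us).
  exact: max_card.
have exP : exists n, P n by exists 1.
case: (ex_maxnP exP Pm) => n /existsP[s /and3P[us sW ds]] maxn.
have n0 : 0 < n := maxn _ P1.
have s0 : (s : seq T) != [::] by rewrite -size_eq0 size_tuple -lt0n.
exists s; first by rewrite us sW ds s0.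
move=> y yW dy; apply/negPn/negP => ys.
have : P n.+1; last by move/maxn; rewrite ltnn.
apply/existsP; exists [tuple of y :: s]; rewrite /= ys us yW sW /=.
case: (tval s) ds s0 dy {us sW ys} => //= z t -> _.
by rewrite d_sym => ->.
Qed.

(** The neighbour [f j] of the head of a longest path, other than [f 1], is its last vertex:
    otherwise [f j] would have the three neighbours [f j.-1], [f j.+1] and [f 0]. The cycle is given
    as a periodic sequence on [nat], so that arcs need no reduction modulo [L]. *)
Lemma two_regular_cycle : W != set0 -> exists L c,
  [/\ 2 < L, (forall k, c (k + L) = c k), (forall i j, c i = c j -> i = j %[mod L]),
      (forall k, d (c k) (c k.+1) /\ c k \in W) &
      forall k y, y \in W -> d (c k.+1) y -> y = c k \/ y = c k.+2].
Proof.
move=> W0; have [s /and4P[us sW ds s0] hs] := longest_path W0.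
have /set0Pn[x0 x0W] := W0.
pose L := size s; pose f := nth x0 s.
have L0 : 0 < L by rewrite lt0n size_eq0.
have fW i : i < L -> f i \in W by move=> iL; apply: (allP sW); rewrite mem_nth.
have fE i : i.+1 < L -> d (f i) (f i.+1) by move: ds => /(sortedP x0); apply.
have finj i j : i < L -> j < L -> f i = f j -> i = j.
  by move=> iL jL /eqP; rewrite nth_uniq // => /eqP.
have f0 y : y \in W -> d (f 0) y -> exists2 j, j < L & y = f j.
  move=> yW; have -> : f 0 = head y s by rewrite /f; case: (s) s0.
  by move/(hs _ yW)/(nthP x0) => [j jL <-]; exists j.
have [z [zW d0z _]] := other_nbr x0 (fW 0 L0).
have [j1 j1L ej1] := f0 _ zW d0z.
have L1 : 1 < L.
  by case: j1 j1L ej1 => [|j] //; [move=> _ zE; rewrite zE d_irr in d0z|move=> jL _; apply: leq_ltn_trans jL].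
have {z zW d0z j1 j1L ej1} [z [zW d0z z1]] := other_nbr (f 1) (fW 0 L0).
have [j jL ej] := f0 _ zW d0z; rewrite {z}ej in zW d0z z1.
have j2 : 1 < j.
  by case: j {jL zW} d0z z1 => [|[|j]] //; [rewrite d_irr|rewrite eqxx].
have L2 : 2 < L := leq_ltn_trans j2 jL.
have ejL : j.+1 = L.
  apply/eqP; rewrite eqn_leq jL /= leqNgt; apply/negP => jL1.
  have dj0 : d (f j) (f 0) by rewrite d_sym.
  have djS := fE _ jL1.
  have jP : j.-1.+1 = j by rewrite prednK // ltnW.
  have djP : d (f j) (f j.-1) by rewrite d_sym -{2}jP fE // jP.
  have jPL : j.-1 < L by apply: leq_ltn_trans jL; apply: leq_pred.
  have nPS : f j.-1 != f j.+1.
    by apply/eqP => /(finj _ _ jPL jL1) h; move: h jP; clear; lia.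
  case: (two_nbrs zW (fW _ jPL) (fW _ jL1) (fW _ L0) djP djS dj0 nPS) => h.
    by have := finj _ _ L0 jPL h; move: j2; clear; lia.
  by have := finj _ _ L0 jL1 h.
have dL0 : d (f j) (f 0) by rewrite d_sym.
pose c k := f (k %% L).
have cW k : c k \in W by apply: fW; rewrite ltn_mod.
have cE k : d (c k) (c k.+1).
  rewrite /c; have kL := ltn_pmod k L0.
  have [h|h] := ltnP (k %% L).+1 L.
    have -> : k.+1 %% L = (k %% L).+1 by rewrite -addn1 -modnDml addn1 modn_small.
    exact: fE.
  have eL : (k %% L).+1 = L by apply/eqP; rewrite eqn_leq kL.
  have -> : k.+1 %% L = 0 by rewrite -addn1 -modnDml addn1 eL modnn.
  by have -> : k %% L = j by move: eL ejL; clear; lia.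
have cI i k : c i = c k -> i = k %[mod L] by move/finj; apply; rewrite ltn_mod.
exists L, c; split=> // [k|k y yW dy]; first by rewrite /c modnDr.
apply: (two_nbrs (cW k.+1)) => //; first by rewrite d_sym.
apply/eqP => /cI/eqP; rewrite -addn2 -{1}[k]addn0 eqn_modDl mod0n modn_small //.
Qed.
End TwoRegular.

Section Windows.
Variables (T : finType) (L : nat) (c : nat -> T).
Hypothesis L0 : 0 < L.
Hypothesis cL : forall k, c (k + L) = c k.
Hypothesis cI : forall i j, c i = c j -> i = j %[mod L].

Lemma periodic_mod k : c (k %% L) = c k.
Proof.
rewrite {2}(divn_eq k L) addnC; elim: (k %/ L) => [|m IHm]; first by rewrite addn0.
by rewrite mulSn [L + _]addnC addnA cL.
Qed.

Definition support := [set c k | k : 'I_L].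

Lemma mem_support k : c k \in support.
Proof.
by rewrite -periodic_mod; apply/imsetP; exists (Ordinal (ltn_pmod k L0)).
Qed.

Lemma supportP x : reflect (exists k, x = c k) (x \in support).
Proof.
by apply: (iffP imsetP) => [[k _ ->]|[k ->]]; [exists k|apply/imsetP; apply: mem_support].
Qed.

Lemma inj_ord : injective (fun k : 'I_L => c k).
Proof. by move=> i j /cI; rewrite !modn_small // => /val_inj. Qed.

Lemma card_support : #|support| = L.
Proof. by rewrite card_imset ?card_ord //; apply: inj_ord. Qed.

Lemma card_window (S : {set T}) j :
  #|S :&: support| = \sum_(j <= i < j + L) (c i \in S).
Proof.
rewrite (shift_window (f := fun i => c i \in S)) => [|i]; last by rewrite cL.
rewrite big_mkord -sum1_card; under eq_bigl do rewrite inE andbC.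
rewrite big_mkcondr /support big_imset /=; last by move=> i k _ _; apply: inj_ord.
by rewrite [RHS](eq_bigr (fun i : 'I_L => if c i \in S then 1 else 0)) // => i _; case: (_ \in S).
Qed.
End Windows.

(** * Robust graphs of order [2b + 3] are induced odd cycles *)

Section OddCycle.
Variables (T : finType) (e : rel T).
Hypothesis e_sym : symmetric e.
Hypothesis e_irr : irreflexive e.
Implicit Types (A I K S W : {set T}) (x y : T).

Definition induced_cycle W L (c : nat -> T) :=
  [/\ (forall k, c (k + L) = c k), (forall i j, c i = c j -> i = j %[mod L]),
      W = support L c, (forall k, e (c k) (c k.+1)) &
      forall i m, 1 < m -> m.+1 < L -> ~~ e (c i) (c (i + m))].

Lemma adj_indicator (c : nat -> T) S : stable e S -> (forall k, e (c k) (c k.+1)) ->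
  forall i, ~~ ((c i \in S) && (c i.+1 \in S)).
Proof.
move=> /stableP sS ec i; apply/negP => /andP[h1 h2].
by have := sS _ _ h1 h2; rewrite ec.
Qed.

Lemma robust_odd_cycle W b : alpha_le e W b.+1 -> robust e W b -> #|W| = b.*2 + 3 ->
  exists c, induced_cycle W (b.*2 + 3) c.
Proof.
move=> aW rW cW.
have [d [d_sym de aWd crit]] := critical_subgraph e_sym aW.
have d_irr : irreflexive d by move=> x; apply: contraFF (e_irr x); apply: de.
have rWd := robust_sub de rW.
have deg := critical_degree d_sym d_irr aWd rWd cW crit.
have W0 : W != set0 by rewrite -card_gt0 cW addn3.
have [L [c [L2 cL cI cE cN]]] := two_regular_cycle d_sym d_irr deg W0.
have L0 : 0 < L := ltnW (ltnW L2).
have cNW k y : y \in W -> d (c k) y -> y = c (k + L.-1) \/ y = c (k + L.-1).+2.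
  move=> yW dy; apply: cN => //.
  by rewrite -addnS prednK // cL.
(* In an even cycle each of the two alternating classes contains the neighbourhood of the other, and
   both would have to expand. *)
have oL : odd L.
  apply/negPn/negP => oL.
  have om k : odd (k %% L) = odd k.
    by rewrite {2}(divn_eq k L) oddD oddM (negbTE oL) andbF.
  pose A (o : bool) := [set c k | k : 'I_L & odd k == o].
  have AP x o : reflect (exists2 k, odd k = o & x = c k) (x \in A o).
    apply: (iffP imsetP) => [[k]|[k ko ->]]; first by rewrite inE => /eqP ko ->; exists k.
    exists (Ordinal (ltn_pmod k L0)); first by rewrite inE /= om ko.
    by rewrite /= periodic_mod.
  have AW o : A o \subset W by apply/subsetP => x /AP[k _ ->]; have [] := cE k.
  have nA o : nb d (A o) W \subset A (~~ o).
    apply/subsetP => y /nbP[yW [x /AP[k ko ->]]] /(cNW _ _ yW).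
    have oP : odd L.-1 by move: oL; rewrite -(prednK L0) /= negbK.
    by case=> ->; apply/AP; [exists (k + L.-1)|exists (k + L.-1).+2];
      rewrite //= ?negbK oddD oP ko addbT.
  have sA o : stable d (A o).
    apply/stableP => x y xA yA; apply/negP => dxy.
    have yW := subsetP (AW o) _ yA.
    have /(subsetP (nA o))/AP[k ko yk] : y \in nb d (A o) W by apply/nbP; split=> //; exists x.
    case/AP: yA => i io; rewrite yk => /cI ki.
    by move: ko; rewrite -om ki om io; case: (o).
  have A0 o : A o != set0.
    apply/set0Pn; exists (c o); apply/AP; exists o => //; by case: (o).
  have lt o : #|A o| < #|A (~~ o)|.
    apply: leq_trans _ (subset_leq_card (nA o)).
    have h := robust_expand d_sym d_irr aWd rWd (sA o) (AW o) (A0 o). exact: h.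
  by have := ltn_trans (lt true) (lt false); rewrite ltnn.
pose Z := support L c; pose m := L./2.
have Lm : L = m.*2.+1 by rewrite -[LHS]odd_double_half oL.
have ZW : Z \subset W by apply/subsetP => x /(supportP L0 cL)[k ->]; have [] := cE k.
have cZ : #|Z| = L := card_support cI.
(* A stable set of [b.+1] vertices has at most [m] on the odd cycle, so at least half of the
   [2(b + 1 - m)] vertices off it; this part has no neighbour on the cycle and cannot expand unless
   it is empty. *)
have eqZ : Z = W.
  have [S [sS SW cS]] := robust_stable rWd (clq0 d) (sub0set W).
  rewrite setD0 in SW.
  have dE k : d (c k) (c k.+1) by have [] := cE k.

  have hSZ : #|S :&: Z| <= m.
    rewrite (card_window cL cI S 0) add0n Lm.
    have adj i : ~~ ((c i \in S) && (c i.+1 \in S)).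
      apply/negP => /andP[h1 h2]; move/stableP: sS => /(_ _ _ h1 h2); by rewrite dE.
    have := odd_arc adj m 0; rewrite add0n => h; apply: leq_trans h _.
    have := adj m.*2; rewrite -Lm -[L]add0n cL andbC => /negbTE->.
    by rewrite addn0.
  pose A := S :\: Z.
  have cA : b.+1 <= #|A| + m.
    by have := cardsID Z S; rewrite -/A; move: hSZ cS; clear; card_lia.
  have cWZ : #|W :\: Z| + L = b.*2 + 3.
    by rewrite -cZ -cW -(cardsID Z W) (setIidPr ZW) addnC.
  apply/eqP; rewrite eqEcard ZW cZ cW.
  have [A0|A0] := eqVneq A set0.
    by rewrite A0 cards0 in cA; rewrite Lm; move: cA; clear; card_lia.
  exfalso; have sA : stable d A by apply: stableS sS; apply: subsetDl.
  have AW : A \subset W := subset_trans (subsetDl _ _) SW.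
  have := robust_expand d_sym d_irr aWd rWd sA AW A0.
  have AWZ : A \subset W :\: Z by rewrite setSD.
  have eN : nb d A W = nb d A (W :\: Z).
    rewrite nbD; apply/eqP; rewrite eqEsubset subsetDl andbT; apply/subsetP => y yN.
    rewrite in_setD yN andbT; apply/negP => /(supportP L0 cL)[k yk].
    case/nbP: yN => yW [x xA]; rewrite yk d_sym => /(cNW _ _ (subsetP AW _ xA)) h.
    move: xA; rewrite in_setD => /andP[/negP xZ _]; apply: xZ.
    by case: h => ->; apply: mem_support.
  have := stable_nb AWZ sA; rewrite -eN.
  by move: cWZ cA Lm; clear; card_lia.
have eL : L = b.*2 + 3 by rewrite -cZ eqZ.
rewrite -eL in cW *; exists c; split=> //.
- by move=> k; apply: de; have [] := cE k.
(* A chord of even length closes an odd cycle on [k + 1 = 2h + 1] vertices. Without the edge [K] the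
   others form an arc of [2g] vertices, so a stable set has at most [h + g = b] vertices, against
   robustness. *)
have chord i k : ~~ odd k -> 1 < k -> k.+1 < L -> ~~ e (c i) (c (i + k)).
  move=> ok k1 kL; apply/negP => eik.
  have eE j : e (c j) (c j.+1) by apply: de; have [] := cE j.
  have k2L : k.+2 < L.
    rewrite ltn_neqAle kL andbT; apply: contraNneq ok => kE.
    by move: oL; rewrite -kE /= negbK.
  pose K := [set c (i + k).+1; c (i + k).+2].
  have cK : clq e K := clq2 e_sym (eE _).
  have KW : K \subset W by rewrite -eqZ subUset !sub1set !mem_support.
  case/negP: (rW _ cK KW); apply/alpha_leP => S sS SW.
  have adj := adj_indicator sS eE.
  have SW' : S = S :&: Z by apply/esym/setIidPl; rewrite eqZ; apply: subset_trans SW (subsetDl _ _).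
  rewrite SW' (card_window cL cI S i).
  have [h kE] : exists h, k = h.*2 by exists k./2; rewrite -[LHS]odd_double_half (negbTE ok).
  have [g gE] : exists g, L = (k + 3 + g.*2).
    exists (L - k - 3)./2; rewrite halfK.
    have oo : odd (L - k - 3) = false.
      by rewrite !oddB ?oL ?(negbTE ok) //; move: k2L; clear; lia.
    by rewrite oo subn0; move: k2L; clear; lia.
  rewrite (big_cat_nat (n := (i + k).+1)) /=; [|by lia|by lia].
  rewrite [X in _ + X <= _]big_ltn; last by lia.
  rewrite [X in _ + (_ + X) <= _]big_ltn; last by lia.
  have nS1 : c (i + k).+1 \notin S.
    by apply/negP => /(subsetP SW); rewrite !inE eqxx.
  have nS2 : c (i + k).+2 \notin S.
    by apply/negP => /(subsetP SW); rewrite !inE eqxx orbT.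
  rewrite (negbTE nS1) (negbTE nS2) !add0n.
  have h1 := odd_arc adj h i; rewrite -kE in h1.
  have nb_ : (c i \in S) && (c (i + k) \in S) = false.
    by apply/negP => /andP[u v]; move/stableP: sS => /(_ _ _ u v); rewrite eik.
  rewrite nb_ addn0 in h1.
  have h2 := even_arc adj g (i + k).+3.
  have e3 : (i + k).+3 + g.*2 = i + L by rewrite gE; clear; lia.
  rewrite e3 in h2; apply: leq_trans (leq_add h1 h2) _.
  by move: gE kE eL; clear; lia.
(* A chord of odd length [k] spans the even length [L - k] on the other side. *)
move=> i k k1 kL; have [ok|] := boolP (odd k); last by move=> ok; apply: chord.
have : ~~ e (c (i + k)) (c (i + k + (L - k))).
  apply: chord; first by rewrite oddB ?oL ?ok //; move: kL; clear; lia.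
    by move: kL; clear; lia.
  by move: k1 kL; clear; lia.
by rewrite e_sym -addnA subnKC ?cL //; move: kL; clear; lia.
Qed.
End OddCycle.

(** * The extremal case *)

Section CycleFacts.
Variables (T : finType) (e : rel T).
Hypothesis e_sym : symmetric e.
Hypothesis e_irr : irreflexive e.
Implicit Types (A I K S W : {set T}) (x y : T).

Lemma card_sub_count A (s : seq T) : {subset A <= s} -> #|A| <= count (mem A) s.
Proof.
move=> As; rewrite cardE -size_filter; apply: uniq_leq_size; first exact: enum_uniq.
by move=> x; rewrite mem_enum mem_filter => xA; rewrite /= xA As.
Qed.

Lemma drop_intro (Ks : seq {set T}) a : all (clq e) Ks ->
  (forall I, stable e I -> (forall K, K \in Ks -> [disjoint K & I]) -> #|I| <= a) ->
  drop e (size Ks) setT a.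
Proof.
move=> cK h; exists Ks; split=> //; apply/alpha_leP => I sI IW; apply: h => // K KKs.
suff : I \subset [set: T] /\ forall K, K \in Ks -> [disjoint K & I] by case=> _; apply.
elim: Ks [set: T] {cK KKs} IW => [|K' Ks IH] X //= /IH[].
rewrite subsetD => /andP[IX dI] hK; split=> // K0.
by rewrite inE => /orP[/eqP->|/hK//]; rewrite disjoint_sym.
Qed.

Variables (W : {set T}) (L : nat) (c : nat -> T).
Hypothesis Wc : induced_cycle e W L c.
Hypothesis L2 : 2 < L.

Let L0 : 0 < L := ltnW (ltnW L2).

Lemma cycle_mem k : c k \in W.
Proof. by case: Wc => cL _ -> _ _; apply: mem_support. Qed.

Lemma cycle_nbrs k y : y \in W -> e (c k) y -> y = c (k + L.-1) \/ y = c k.+1.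
Proof.
case: Wc => cL cI -> cE ch /(supportP L0 cL)[j ->].
pose m := (j + k * L.-1) %% L.
have -> : c j = c (k + m).
  rewrite -(periodic_mod cL) -[RHS](periodic_mod cL) /m modnDmr addnCA -mulnS prednK //.
  by rewrite addnC modnMDl.
have mL : m < L by rewrite ltn_mod.
have [m1|m1|->] := ltngtP m 1; last by rewrite addn1; right.
  by have -> : m = 0 by [move: m1; clear; lia]; rewrite addn0 e_irr.
have [m2|m2] := ltnP m.+1 L; first by rewrite (negbTE (ch k m m1 m2)).
by left; have -> : m = L.-1 by move: mL m2; clear; lia.
Qed.

Lemma cycle_deg x : x \in W -> #|nb e [set x] W| <= 2.
Proof.
case: (Wc) => cL cI eW cE ch; rewrite {1}eW => /(supportP L0 cL)[k ->].
have : nb e [set c k] W \subset [set c (k + L.-1); c k.+1].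
  apply/subsetP => y; rewrite nb1 => /andP[yW /(cycle_nbrs yW)] [] ->; by rewrite !inE eqxx ?orbT.
by move/subset_leq_card/leq_trans; apply; rewrite cards2; case: (_ != _).
Qed.

(* The arc [c k, ..., c (k + 2h)] is closed into an odd cycle outside [W]; the
   remaining [g] edges of the cycle are matched, and [j] of them are removed. *)
Lemma arc_drop k h g j (Ks : seq {set T}) t : L = h.*2.+1 + g.*2 -> j <= g ->
  all (clq e) Ks ->
  (forall I, stable e I -> (forall K, K \in Ks -> [disjoint K & I]) ->
     ((c k \in I) && (c (k + h.*2) \in I)) + #|I :\: W| <= t) ->
  drop e (j + size Ks) setT (h + (g - j) + t).
Proof.
case: (Wc) => cL cI eW cE ch eL jg cK hI.
pose s i := (k + h.*2).+1 + i.*2.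
pose K' i := [set c (s i); c (s i).+1].
have := @drop_intro ([seq K' i | i <- iota 0 j] ++ Ks) (h + (g - j) + t).
rewrite size_cat size_map size_iota; apply.
  rewrite all_cat cK andbT; apply/allP => K /mapP[i _ ->]; apply: clq2 => //; exact: cE.
move=> I sI dI; rewrite -(cardsID W I) eW (card_window cL cI I k) -eW.
have adj := adj_indicator sI cE.
rewrite (big_cat_nat (n := (k + h.*2).+1)) /=; [|by lia|by lia].
rewrite (big_cat_nat (n := s j) (m := (k + h.*2).+1)) /=; [|by rewrite /s; lia|by rewrite /s; lia].
have -> : \sum_((k + h.*2).+1 <= i < s j) (c i \in I) = 0.
  rewrite big_nat_cond big1 // => i; rewrite andbT => /andP[i1 i2].
  apply/eqP; rewrite eqb0; apply/negP => iI.
  pose r := (i - (k + h.*2).+1)./2.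
  have rj : r < j by rewrite /r; move: i1 i2; rewrite /s; clear; lia.
  have /dI dK : K' r \in [seq K' i | i <- iota 0 j] ++ Ks.
    by rewrite mem_cat; apply/orP; left; apply/mapP; exists r => //; rewrite mem_iota.
  have : c i \in K' r.
    have : i = s r \/ i = (s r).+1 by rewrite /s /r; move: i1; clear; lia.
    by case=> ->; rewrite !inE eqxx ?orbT.
  by move/(disjointFr dK); rewrite iI.
rewrite add0n.
have h1 := odd_arc adj h k.
have h2 := even_arc adj (g - j) (s j).
have e2 : s j + (g - j).*2 = k + L by rewrite /s eL; move: jg; clear; lia.
rewrite e2 in h2.
have h3 : ((c k \in I) && (c (k + h.*2) \in I)) + #|I :\: W| <= t.
  by apply: hI => // K KKs; apply: dI; rewrite mem_cat KKs orbT.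
have := leq_add (leq_add h1 h2) h3.
by move: (\sum_(k <= i < _) _) (\sum_(s j <= i < _) _) (#|_|) => a1 a2 a3; clear; lia.
Qed.
End CycleFacts.

Section Alternating.
Variables (T : finType) (e : rel T) (W : {set T}) (q : nat) (c : nat -> T).
Hypothesis e_sym : symmetric e.
Hypothesis e_irr : irreflexive e.
Hypothesis Wc : induced_cycle e W (q.*2 + 3) c.

(* Every second vertex of the cycle from [c k] on, skipping one after [s] steps. *)
Definition alternating k s := [set c (k + (t.*2 + (s < t))) | t : 'I_q.+1].

Lemma alternating_stable k s : stable e (alternating k s).
Proof.
case: (Wc) => cL cI _ cE ch; apply/stableP.
have key (t t' : 'I_q.+1) : t < t' ->
    ~~ e (c (k + (t.*2 + (s < t)))) (c (k + (t'.*2 + (s < t')))).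
  move=> tt'; have t'q := ltn_ord t'.
  have le : (s < t) <= (s < t') by case: (ltnP s t) => // st; rewrite (ltn_trans st tt').
  have b1 : (s < t') <= 1 by case: (_ < _).
  have -> : k + (t'.*2 + (s < t')) =
            k + (t.*2 + (s < t)) + (t'.*2 + (s < t') - (t.*2 + (s < t))).
    by move: tt' le; clear; lia.
  apply: ch.
    by move: tt' le; clear; lia.
  by move: t'q le tt' b1; clear; lia.
move=> _ _ /imsetP[t _ ->] /imsetP[t' _ ->]; apply/negbTE.
have [tt'|tt'|/val_inj->] := ltngtP t t'; rewrite ?e_irr //; first exact: key.
by rewrite e_sym; apply: key.
Qed.

Lemma card_alternating k s : #|alternating k s| = q.+1.
Proof.
case: (Wc) => cL cI _ cE ch; rewrite card_imset ?card_ord // => t t' /cI/eqP.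
rewrite eqn_modDl; have tq := ltn_ord t; have t'q := ltn_ord t'.
have b1 (n : nat) : (s < n) <= 1 by case: (_ < _).
rewrite !modn_small; try by [move: tq (b1 t); clear; lia | move: t'q (b1 t'); clear; lia].
move=> /eqP h; apply: val_inj => /=.
move: h (b1 t) (b1 t'); clear; lia.
Qed.
End Alternating.

(** * Triangle-free graphs of order [2q + 7]: minimum degree three *)

Section Extremal.
Variables (T : finType) (e : rel T) (q : nat).
Hypothesis e_sym : symmetric e.
Hypothesis e_irr : irreflexive e.
Hypothesis aT : alpha_le e setT q.+2.
Hypothesis rT : robust e setT q.+1.
Hypothesis tf : forall x y z, e x y -> e x z -> ~~ e y z.
Hypothesis cT : #|T| = q.*2 + 7.
Hypothesis nD : ~ drop e 3 setT q.
Implicit Types (A I K S W : {set T}) (x y : T).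

(** Otherwise a third clique would reach stability number [q]. *)
Lemma rest_robust u v K : e u v -> clq e K ->
  alpha_le e (setT :\: [set u; v] :\: K) q.+1 ->
  robust e (setT :\: [set u; v] :\: K) q.
Proof.
move=> uv cK aK K' cK' _; apply/negP => aK'; apply: nD.
apply: (drop_cons (clq2 e_sym uv)); apply: (drop_cons cK); apply: (drop_cons cK').
exact: drop0.
Qed.

Lemma robust_deg2 W b x : alpha_le e W b.+1 -> robust e W b -> #|W| = b.*2 + 3 ->
  x \in W -> #|nb e [set x] W| = 2.
Proof.
move=> aW rW cW xW; have [c Wc] := robust_odd_cycle e_sym e_irr aW rW cW.
apply/eqP; rewrite eqn_leq (robust_deg e_sym e_irr aW rW xW) andbT.
by apply: (cycle_deg e_irr Wc); rewrite // addn3.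
Qed.

Section Pendant.
Variables (u v a b : T).
Hypothesis uv : e u v.
Hypothesis au : e a u.
Hypothesis ab : e a b.
Hypothesis bu : b != u.
Hypothesis va : v != a.
Hypothesis Na : forall z, e a z -> z \in [:: u; b].
Let W := setT :\: [set u; v] :\: [set a; b].

Lemma pendant_notin : [/\ ~~ e a v, b != v, a \in setT :\: [set u; v] &
  b \in setT :\: [set u; v]].
Proof.
have ua : e u a by rewrite e_sym.
have av : ~~ e a v := tf ua uv.
have bv : b != v by apply: contraNneq av => <-.
split=> //; rewrite !inE ?negb_or ?bu ?bv //.
by rewrite (edge_neq e_irr au) eq_sym va.
Qed.

Lemma pendant_alpha : alpha_le e W q.+1.
Proof.
apply/alpha_leP => I sI IW.
have nI z : z \in [:: u; b; a] -> z \notin I.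
  move=> zP; apply/negP => /(subsetP IW); rewrite !inE.
  by move: zP; rewrite !inE => /or3P[->|->|->]; rewrite ?orbT ?andbF.
have /alpha_leP/(_ (a |: I)) := aT; rewrite subsetT cardsU1 nI ?inE ?eqxx ?orbT // => h.
suff /h/(_ isT) : stable e (a |: I) by [].
apply: stableU1 => // y yI; apply/negP => /Na yN.
have : y \notin I by apply: nI; move: yN; rewrite !inE => /orP[]->; rewrite ?orbT.
by rewrite yI.
Qed.

Lemma pendant_robust : robust e W q.
Proof. exact: rest_robust uv (clq2 e_sym ab) pendant_alpha. Qed.

Lemma pendant_card : #|W| = q.*2 + 3.
Proof.
have [_ _ aW bW] := pendant_notin.
by rewrite /W (card_edge e_irr ab) // (card_edge e_irr uv) ?inE // cardsT cT; card_lia.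
Qed.

(** With no neighbour of [v] in [I], both [v] and [a] could be added, giving [q + 3] stable
    vertices. *)
Lemma pendant_rich I : stable e I -> I \subset W -> q < #|I| -> exists2 y, y \in I & e v y.
Proof.
move=> sI IW cI; have [av bv _ _] := pendant_notin.
have [/exists_inP //|] := boolP [exists y in I, e v y].
rewrite negb_exists => /forallP h.
have nW z : z \in [:: u; v; a; b] -> z \notin I.
  move=> zP; apply/negP => /(subsetP IW); rewrite !inE.
  by move: zP; rewrite !inE => /or4P[->|->|->|->]; rewrite ?orbT ?andbF.
have sv : stable e (v |: I).
  by apply: stableU1 => // y yI; have := h y; rewrite yI.
have sa : stable e (a |: (v |: I)).
  apply: stableU1 => // y; rewrite inE in_set1 => /orP[/eqP->//|yI].
  apply/negP => /Na yN; have : y \notin I by apply: nW; move: yN; rewrite !inE => /orP[]->; rewrite ?orbT.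
  by rewrite yI.
have /alpha_leP/(_ _ sa (subsetT _)) := aT.
rewrite !cardsU1 !inE eq_sym (negbTE va) (negbTE (nW a _)) ?inE ?eqxx ?orbT //.
by rewrite (negbTE (nW v _)) ?inE ?eqxx ?orbT //; move: cI; clear; card_lia.
Qed.
End Pendant.

(** The rests [W] and [W'] differ by the exchange of [v'] and [v], and both are cycles, so by
    degrees [v] and [v'] have the same neighbours in their common part. A maximum stable set of [W]
    through [v'] then contains no neighbour of [v], against [pendant_rich]. *)
Lemma degree2_nbr a u b v v' : e a u -> e a b -> b != u ->
  (forall z, e a z -> z \in [:: u; b]) ->
  e u v -> e u v' -> v != a -> v' != a -> v = v'.
Proof.
move=> au ab bu Na uv uv' va v'a; apply/eqP/negPn/negP => vv'.
pose W := setT :\: [set u; v] :\: [set a; b].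
pose W' := setT :\: [set u; v'] :\: [set a; b].
have rW := pendant_robust uv ab Na.
have aW := pendant_alpha v Na.
have cW := pendant_card uv au ab bu va.
have cW' := pendant_card uv' au ab bu v'a.
have aW' := pendant_alpha v' Na.
have rW' := pendant_robust uv' ab Na.
have [_ bv _ _] := pendant_notin uv au ab bu va.
have [_ bv' _ _] := pendant_notin uv' au ab bu v'a.
have v'W : v' \in W.
  by rewrite !inE !negb_or v'a (eq_sym v' b) bv' (eq_sym v' u) (edge_neq e_irr uv') (eq_sym v' v) vv'.
have vW' : v \in W'.
  by rewrite !inE !negb_or va (eq_sym v b) bv (eq_sym v u) (edge_neq e_irr uv) vv'.
have eWW' : W :\ v' = W' :\ v.
  by apply/setP => z; rewrite !inE; do 5!case: (z == _).
have twin y : y \in W -> y != v' -> e y v' = e y v.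
  move=> yW yv'; have yW' : y \in W'.
    by have : y \in W' :\ v; [rewrite -eWW' in_setD1 yv' yW|rewrite in_setD1 => /andP[]].
  have := robust_deg2 aW rW cW yW; have := robust_deg2 aW' rW' cW' yW'.
  rewrite (cardsD1 v' (nb _ _ W)) (cardsD1 v (nb _ _ W')) -!nbD -/W -/W' eWW' !nb1 v'W vW' /=.
  by move=> <- /eqP; rewrite eqn_add2r; case: (e y v); case: (e y v').
have d2 := robust_deg2 aW rW cW v'W.
have /cards2P[c1 [c2 [c12 eN]]] : #|nb e [set v'] W| == 2 by rewrite d2.
have [v'c1 v'c2 c1W c2W] : [/\ e v' c1, e v' c2, c1 \in W & c2 \in W].
  have : c1 \in nb e [set v'] W by rewrite eN !inE eqxx.
  have : c2 \in nb e [set v'] W by rewrite eN !inE eqxx orbT.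
  by rewrite !nb1 => /andP[-> ->] /andP[-> ->].
(* To get a maximum stable set through [v'], one cycle neighbour [c1] is avoided by robustness and
   the other, [c2], is exchanged for [v']. *)
have c1K : [set c1] \subset W by rewrite sub1set.
have [S0 [sS0 S0W cS0]] := robust_stable rW (clq1 e c1) c1K.
pose S := v' |: (S0 :\ c2).
have S0W' : S0 \subset W := subset_trans S0W (subsetDl _ _).
have c1S : c1 \notin S0 by apply/negP => /(subsetP S0W); rewrite !inE eqxx.
have sS : stable e S.
  apply: stableU1 => //; last by apply: stableS sS0; apply: subsetDl.
  move=> y; rewrite in_setD1 => /andP[yc2 yS]; apply/negP => v'y.
  have : y \in nb e [set v'] W by rewrite nb1 v'y (subsetP S0W').
  by rewrite eN !inE (negbTE yc2) orbF => /eqP yc1; rewrite yc1 (negbTE c1S) in yS.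
have SW : S \subset W.
  by rewrite subUset sub1set v'W; apply: subset_trans (subsetDl _ _) S0W'.
have cS : q < #|S|.
  apply: leq_trans cS0 _; rewrite cardsU1 (cardsD1 c2 S0) !in_setD1.
  have [v'S|v'S] := boolP (v' \in S0); last by rewrite andbF /= leq_add2r; case: (_ \in _).
  have c2S : c2 \in S0 = false.
    by apply/negP => c2S; move/stableP: sS0 => /(_ _ _ v'S c2S); rewrite v'c2.
  by rewrite c2S add0n leq_addl.
have [y yS vy] := pendant_rich uv au ab bu va Na sS SW cS.
have [yv'|yv'] := eqVneq y v'.
  by have := tf uv uv'; rewrite -yv' vy.
have yW := subsetP SW _ yS.
have yv : e y v by rewrite e_sym.
have v'S : v' \in S by rewrite !inE eqxx.
by move/stableP: sS => /(_ _ _ yS v'S); rewrite twin ?yv.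
Qed.

(** By [degree2_nbr], used at [a] and then at [u], the vertex [v] has a single neighbour [w] besides
    [u]. Robustness gives a maximum stable set of the rest avoiding [w], hence without neighbours of
    [v]. *)
Lemma no_degree2 a u b : e a u -> e a b -> b != u ->
  (forall z, e a z -> z \in [:: u; b]) -> False.
Proof.
move=> au ab bu Na.
have ua : e u a by rewrite e_sym.
have [v uv va] := nbr_other e_sym e_irr aT rT u a.
have Nu z : e u z -> z \in [:: v; a].
  move=> uz; rewrite !inE; have [->|za] := eqVneq z a; first by rewrite orbT.
  by rewrite (degree2_nbr au ab bu Na uz uv za va) eqxx.
have [w vw wu] := nbr_other e_sym e_irr aT rT v u.
have Nv z : e v z -> z != u -> z = w.
  move=> vz zu; apply: (degree2_nbr uv ua _ Nu vz vw) => //.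
  by rewrite eq_sym.
have rW := pendant_robust uv ab Na.
pose W := setT :\: [set u; v] :\: [set a; b].
pose K := [set w] :&: W.
have cK : clq e K.
  by apply/clqP => y z; rewrite !in_setI !in_set1 => /andP[/eqP-> _] /andP[/eqP-> _]; rewrite eqxx.
have [S [sS SK cS]] := robust_stable rW cK (subsetIr _ _).
have SW : S \subset W := subset_trans SK (subsetDl _ _).
have [y yS vy] := pendant_rich uv au ab bu va Na sS SW cS.
have yW := subsetP SW _ yS.
have yu : y != u by apply: contraTneq yW => ->; rewrite !inE eqxx andbF.
have := subsetP SK _ yS; rewrite in_setD => /andP[/negP[]].
by rewrite /K in_setI yW (Nv y vy yu) inE eqxx.
Qed.

Lemma min_degree3 x : 2 < #|nb e [set x] setT|.
Proof.
have := degT e_sym e_irr aT rT x; rewrite leq_eqVlt => /orP[|//].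
rewrite eq_sym => /cards2P[u [b [ub eN]]]; exfalso.
have Nx z : e x z = (z \in [:: u; b]).
  by have := nb1 e x z setT; rewrite eN !inE.
apply: (@no_degree2 x u b); rewrite ?Nx ?inE ?eqxx ?orbT // 1?eq_sym //.
by move=> z; rewrite Nx.
Qed.

Lemma attached W x : #|nb e [set x] W| <= 2 -> exists2 m, m \notin W & e x m.
Proof.
move=> h; have : ~~ (nb e [set x] setT \subset nb e [set x] W).
  by apply/negP => /subset_leq_card; rewrite leqNgt (leq_ltn_trans h (min_degree3 x)).
case/subsetPn => m; rewrite !nb1 => /andP[_ xm]; rewrite xm andbT => mW.
by exists m.
Qed.
End Extremal.

Fixpoint words n := if n is n'.+1 then [seq a :: w | a <- iota 0 4, w <- words n'] else [:: [::]].

Lemma mem_words s : all (gtn 4) s -> s \in words (size s).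
Proof.
elim: s => [//|a s IHs /andP[a4 /IHs sw]].
rewrite -[words _]/[seq b :: w | b <- iota 0 4, w <- words (size s)].
by apply/allpairsP; exists (a, s); split; rewrite // mem_iota.
Qed.

(* Labels 0, 1 and 2, 3 are the ends of the two edges outside a 7-cycle. *)
Definition good_label (f : nat -> nat) k :=
  [&& f k != f k.+1,
      (f k, f k.+2) \notin [:: (0, 1); (1, 0); (2, 3); (3, 2)],
      has (fun i => f i \in [:: 0; 2]) [:: k; k.+2; k.+4] &
      has (fun i => f i \in [:: 1; 3]) [:: k; k.+2; k.+4]].

Definition good_word s := all (good_label (fun i => nth 0 s (i %% 7))) (iota 0 7).

Lemma no_good_word : all (fun s => ~~ good_word s) (words 7).
Proof. by vm_compute. Qed.

Lemma no_good_labelling (f : nat -> nat) : (forall k, f (k + 7) = f k) ->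
  (forall k, f k < 4) -> ~ (forall k, good_label f k).
Proof.
move=> f7 f4 gf; pose s := [seq f k | k <- iota 0 7].
have s4 : all (gtn 4) s by apply/allP => _ /mapP[k _ ->]; apply: f4.
have := allP no_good_word s (mem_words s4); case/negP.
have eqf i : nth 0 s (i %% 7) = f i.
  rewrite (nth_map 0) ?size_iota ?ltn_mod // nth_iota ?ltn_mod // add0n.
  rewrite {2}(divn_eq i 7) addnC; elim: (i %/ 7) => [|m IHm]; first by rewrite addn0.
  by rewrite mulSn [7 + _]addnC addnA f7.
apply/allP => k _; have := gf k; rewrite /good_label /= !inE.
by rewrite !eqf.
Qed.

(** * Triangle-free graphs of order [2q + 7]: attachments to the odd cycle *)

Section Extremal.
Variables (T : finType) (e : rel T) (q : nat).
Hypothesis e_sym : symmetric e.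
Hypothesis e_irr : irreflexive e.
Hypothesis aT : alpha_le e setT q.+2.
Hypothesis rT : robust e setT q.+1.
Hypothesis tf : forall x y z, e x y -> e x z -> ~~ e y z.
Hypothesis cT : #|T| = q.*2 + 7.
Hypothesis q2 : 1 < q.
Hypothesis nD : ~ drop e 3 setT q.
Implicit Types (A I K S W : {set T}) (x y : T).

Lemma attach_at W b c k : induced_cycle e W (b.*2 + 3) c ->
  exists2 m, m \notin W & e (c k) m.
Proof.
move=> Wc; apply: (attached e_sym e_irr aT rT tf cT nD).
apply: (cycle_deg e_irr Wc); first by rewrite addn3.
by apply: (cycle_mem Wc); rewrite addn3.
Qed.

(** Steps of two reach every vertex of an odd cycle. *)
Lemma two_step (P : nat -> Prop) (c : nat -> T) L : odd L ->
  (forall k, c (k + L) = c k) -> (forall i j, c i = c j -> P i -> P j) ->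
  (forall k, P k -> P k.+2) -> P 0 -> forall k, P k.
Proof.
move=> oL cL cP PS P0.
have even m : P m.*2 by elim: m => [|m IHm] //; rewrite doubleS; apply: PS.
move=> k; have [ok|ok] := boolP (odd k).
  apply: (cP (k + L)); first exact: cL.
  by rewrite -[k + L]odd_double_half oddD ok oL; apply: even.
by rewrite -[k]odd_double_half (negbTE ok); apply: even.
Qed.

Lemma card_setI_seq I W (s : seq T) : (forall z, z \notin W -> z \in s) ->
  #|I :\: W| <= count (mem I) s.
Proof.
move=> h; have := @card_sub_count _ (I :\: W) s; move=> /(_ _)/leq_trans; apply.
  by move=> z; rewrite inE => /andP[/h].
by apply: sub_count => z /=; rewrite inE => /andP[].
Qed.

Lemma stable_edge I x y : stable e I -> e x y -> (x \in I) && (y \in I) = false.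
Proof. by move=> /stableP sI xy; apply/negP => /andP[xI yI]; rewrite sI in xy. Qed.

Lemma drop3_le a : a <= q -> drop e 3 setT a -> False.
Proof.
move=> aq [Ks [h1 h2 h3]]; apply: nD; exists Ks; split=> //.
by apply: alpha_leS h3.
Qed.

(** The rest would be an induced cycle of length [2q + 5]. If [c k] and [c (k + 2)] were attached to
    different ends of [uv], a pentagon would close, and removing three of the [q + 1] matching edges
    off it would leave at most [1 + (q - 2) + 1] stable vertices. So the whole cycle is attached to
    one end [m], and a further neighbour of the other end lies in a triangle. *)
Lemma edge_rest_not_robust u v : e u v -> ~ robust e (setT :\: [set u; v]) q.+1.
Proof.
move=> uv rW; pose W := setT :\: [set u; v].
have cW : #|W| = q.+1.*2 + 3.
  by rewrite (card_edge e_irr uv) ?inE // cardsT cT; clear; card_lia.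
have aW : alpha_le e W q.+2 by apply: alpha_leS aT; rewrite ?subsetT.
have [c Wc] := robust_odd_cycle e_sym e_irr aW rW cW.
have [cL cI _ cE _] := Wc.
have WP z : z \notin W -> z \in [:: u; v] by rewrite !inE andbT negbK.
have jump m m' k : e m m' -> (forall z, z \notin W -> z \in [:: m; m']) ->
    e (c k) m -> e (c (k + 2)) m' -> False.
  move=> mm' hM km km'.
  have hI I : stable e I -> (forall K, K \in [::] -> [disjoint K & I]) ->
     ((c k \in I) && (c (k + 1.*2) \in I)) + #|I :\: W| <= 1.
    move=> sI _; have := card_setI_seq I hM; rewrite /= addn0 -[1.*2]/2.
    have := stable_edge sI mm'; have := stable_edge sI km; have := stable_edge sI km'.
    by case: (c k \in I); case: (c (k + 2) \in I); case: (m \in I); case: (m' \in I) => //= _ _ _; clear; card_lia.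
  have eL : q.+1.*2 + 3 = 1.*2.+1 + q.+1.*2 by rewrite addnC.
  have L2 : 2 < q.+1.*2 + 3 by rewrite addn3.
  have cK : all (clq e) [::] by [].
  have := arc_drop e_sym Wc L2 eL (q2 : 3 <= q.+1) cK hI.
  by apply: drop3_le; move: q2; clear; lia.
have vW : v \notin W by rewrite !inE eqxx orbT.
have uW : u \notin W by rewrite !inE eqxx.
have vu : e v u by rewrite e_sym.
have main m m' : e m m' -> (forall z, z \notin W -> z \in [:: m; m']) -> e (c 0) m -> False.
  move=> mm' hM m0.
  have all_m k : e (c k) m.
    apply: (@two_step (fun k => e (c k) m) c (q.+1.*2 + 3)) => //.
    - by rewrite oddD odd_double.
    - by move=> i j ->.
    move=> i im; have [n /hM] := attach_at i.+2 Wc; rewrite !inE => /orP[]/eqP-> // im'.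
    by case: (@jump m m' i mm' hM im); rewrite addn2.
  have [z m'z zm] := nbr_other e_sym e_irr aT rT m' m.
  have zW : z \in W.
    apply/negPn/negP => /hM; rewrite !inE (negbTE zm) => /eqP zm'.
    by rewrite zm' e_irr in m'z.
  case: (Wc) => _ _ eW _ _; move: zW; rewrite eW => /(supportP (isT : 0 < q.+1.*2 + 3) cL)[k zk].
  have mz : e m z by rewrite e_sym zk.
  by have := tf mm' mz; rewrite m'z.
have [m /WP] := attach_at 0 Wc; rewrite !inE => /orP[]/eqP->; first exact: main uv WP.
by apply: main vu _ => z /WP; rewrite !inE orbC.
Qed.

Section FourOutside.
Variables (W : {set T}) (c : nat -> T).
Hypothesis Wc : induced_cycle e W (q.*2 + 3) c.

Let L2 : 2 < q.*2 + 3.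
Proof. by rewrite addn3. Qed.

(* [mm'] and [nn'] are the two edges outside the cycle [W]. *)
Definition outside m m' n n' :=
  [/\ e m m', e n n', uniq [:: m; m'; n; n'] &
      forall z, z \notin W -> z \in [:: m; m'; n; n']].

Lemma outsideC m m' n n' : outside m m' n n' -> outside m' m n n'.
Proof.
case=> mm' nn' un h; split=> //; first by rewrite e_sym.
  by move: un; rewrite (perm_uniq (permEl (perm_catCA [:: m] [:: m'] [:: n; n'])) : uniq [:: m; m'; n; n'] = uniq [:: m'; m; n; n']).
by move=> z /h; rewrite !inE; do 4!case: (z == _).
Qed.

Lemma outsideT m m' n n' : outside m m' n n' -> outside n n' m m'.
Proof.
case=> mm' nn' un h; split=> //; first by move: un; rewrite (uniq_catC [:: m; m'] [:: n; n'] : uniq [:: m; m'; n; n'] = uniq [:: n; n'; m; m']).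
by move=> z /h; rewrite !inE; do 4!case: (z == _).
Qed.

(** The arc closed by [m] and [m'] is an odd cycle with at most [h + 1] stable vertices; removing
    [nn'] and two of the [q + 1 - h] matching edges leaves at most [h + (q - 1 - h) + 1 = q]. *)
Lemma near_even m m' n n' k h : outside m m' n n' -> 0 < h -> h.*2 + 5 <= q.*2 + 3 ->
  e (c k) m' -> e (c (k + h.*2)) m -> False.
Proof.
case=> mm' nn' un hM h0 hq km' km.
have hI I : stable e I -> (forall K, K \in [:: [set n; n']] -> [disjoint K & I]) ->
     ((c k \in I) && (c (k + h.*2) \in I)) + #|I :\: W| <= 1.
  move=> sI /(_ _ (mem_head _ _)) dI.
  have nI z : z \in [:: n; n'] -> (z \in I) = false.
    by move=> zn; rewrite (disjointFr dI) // !inE; move: zn; rewrite !inE.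
  have := card_setI_seq I hM; rewrite /= (nI n) ?(nI n') ?inE ?eqxx ?orbT //= !addn0.
  have := stable_edge sI mm'; have := stable_edge sI km; have := stable_edge sI km'.
  by case: (c k \in I); case: (c (k + _) \in I); case: (m \in I); case: (m' \in I) => //= _ _ _; clear; card_lia.
have cK : all (clq e) [:: [set n; n']] by rewrite /= clq2.
have eL : q.*2 + 3 = h.*2.+1 + (q.+1 - h).*2 by move: hq; clear; lia.
have jg : 2 <= q.+1 - h by move: hq; clear; lia.
have := arc_drop e_sym Wc L2 eL jg cK hI.
by apply: drop3_le; move: hq; clear; lia.
Qed.

(** The arc on the other side has the even length [2(q + 1 - h)]. *)
Lemma near_odd m m' n n' k h : outside m m' n n' -> 1 < h -> h.*2.+1 < q.*2 + 3 ->
  e (c k) m' -> e (c (k + h.*2.+1)) m -> False.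
Proof.
move=> oM h1 hq km' km; have [cL _ _ _ _] := Wc.
apply: (@near_even m' m n n' (k + h.*2.+1) (q.+1 - h)) => //; first exact: outsideC.
- by move: hq; clear; lia.
- by move: h1 hq; clear; lia.
have -> : k + h.*2.+1 + (q.+1 - h).*2 = k + (q.*2 + 3) by move: hq; clear; lia.
by rewrite cL.
Qed.

(** Seen from [c k], the alternating vertices are at even distances before the skip and at odd ones
    after it, as in [near_even] and [near_odd]; distance zero would be a triangle. *)
Lemma near_alternating m m' n n' k s t : outside m m' n n' -> 0 < s -> s.*2 + 3 <= q.*2 + 1 ->
  t <= q -> e (c k) m' -> ~~ e (c (k + (t.*2 + (s < t)))) m.
Proof.
move=> oM s0 sq tq km'; apply/negP => km; have [mm' _ _ _] := oM.
have [st|st] := ltnP s t.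
  rewrite st /= addn1 in km.
  by apply: near_odd oM _ _ km' km; move: s0 sq tq st; clear; lia.
rewrite ltnNge st /= addn0 in km.
case: t st km tq => [|t] st km tq.
  rewrite addn0 in km; have := tf km km'; by rewrite mm'.
by apply: near_even oM _ _ km' km => //; move: sq st; clear; lia.
Qed.

Lemma alternating_full k s m n : m != n -> ~~ e m n -> m \notin W -> n \notin W ->
  (forall t, t <= q -> ~~ e (c (k + (t.*2 + (s < t)))) m) ->
  (forall t, t <= q -> ~~ e (c (k + (t.*2 + (s < t)))) n) -> False.
Proof.
move=> mn emn mW nW hm hn; pose J := alternating q c k s.
have JW : J \subset W.
  by apply/subsetP => _ /imsetP[t _ ->]; apply: cycle_mem Wc L2 _.
have nJ z : z \notin W -> z \notin J by apply: contra; apply: (subsetP JW).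
have sN : stable e (n |: J).
  apply: stableU1 => // [_ /imsetP[t _ ->]|]; last exact: alternating_stable Wc _ _.
  by rewrite e_sym; apply: hn; rewrite -ltnS.
have sM : stable e (m |: (n |: J)).
  apply: stableU1 => // y; rewrite inE in_set1 => /orP[/eqP->//|/imsetP[t _ ->]].
  by rewrite e_sym; apply: hm; rewrite -ltnS.
have /alpha_leP/(_ _ sM (subsetT _)) := aT.
rewrite !cardsU1 in_setU1 negb_or mn !nJ // (card_alternating Wc) /=.
by clear; lia.
Qed.

Lemma outside_notin m m' n n' : outside m m' n n' ->
  [/\ m \notin W, m' \notin W, n \notin W & n' \notin W].
Proof.
case=> _ _ un h; have [_ cI eW _ _] := Wc.
have cW : #|W| = q.*2 + 3 by rewrite eW card_support.
have cC : #|~: W| = 4 by have := cardsC W; rewrite cW cT; clear; card_lia.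
have sub : ~: W \subset [set z in [:: m; m'; n; n']].
  by apply/subsetP => z; rewrite !inE => /h; rewrite !inE.
have eC : ~: W = [set z in [:: m; m'; n; n']].
  by apply/eqP; rewrite eqEcard sub cC cardsE (card_uniqP un).
have mem z : z \in [:: m; m'; n; n'] -> z \notin W.
  by move=> zs; rewrite -in_setC eC inE.
by split; apply: mem; rewrite !inE eqxx ?orbT.
Qed.

(** If [m] and [n] are adjacent, [c k], [m'], [m], [n], [n'] form a pentagon, and removing three
    matching edges leaves at most [(q - 2) + 2] stable vertices. Otherwise an alternating set from
    [c k] avoids the neighbours of both [m] and [n]. *)
Lemma cross0 m m' n n' k : outside m m' n n' -> e (c k) m' -> e (c k) n' -> False.
Proof.
move=> oM km' kn'; have [mm' nn' un hM] := oM.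
have [mW _ nW _] := outside_notin oM.
have sq : 1.*2 + 3 <= q.*2 + 1 by move: q2; clear; lia.
have [mn|mn] := boolP (e m n).
  have hI I : stable e I -> (forall K, K \in [::] -> [disjoint K & I]) ->
     ((c k \in I) && (c (k + 0.*2) \in I)) + #|I :\: W| <= 2.
    move=> sI _; have := card_setI_seq I hM; rewrite /= -[0.*2]/0 !addn0 andbb.
    have := stable_edge sI mm'; have := stable_edge sI nn'; have := stable_edge sI mn.
    have := stable_edge sI km'; have := stable_edge sI kn'.
    by case: (c k \in I); case: (m \in I); case: (m' \in I); case: (n \in I);
      case: (n' \in I) => //= _ _ _ _ _; clear; card_lia.
  have eL : q.*2 + 3 = 0.*2.+1 + q.+1.*2 by clear; lia.
  have := arc_drop e_sym Wc L2 eL (q2 : 3 <= q.+1) (isT : all (clq e) [::]) hI.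
  by apply: drop3_le; move: q2; clear; lia.
apply: (@alternating_full k 1 m n) => // [|t tq|t tq].
- by apply: contraTneq un => ->; rewrite /= !inE eqxx orbT.
- exact: near_alternating oM _ sq tq km'.
exact: near_alternating (outsideT oM) _ sq tq kn'.
Qed.

(** As for [cross0], with a heptagon through [c k], [c k.+1], [c (k + 2)] in place of the pentagon:
    only [q] matching edges remain, and three of them are removed. *)
Lemma cross2 m m' n n' k : 2 < q -> outside m m' n n' ->
  e (c k) m' -> e (c (k + 2)) n' -> False.
Proof.
move=> q3 oM km' kn'; have [mm' nn' un hM] := oM.
have [cL _ _ _ _] := Wc.
have [mW _ nW _] := outside_notin oM.
have sq : 2.*2 + 3 <= q.*2 + 1 by move: q3; clear; lia.
have [mn|mn] := boolP (e m n).
  have hI I : stable e I -> (forall K, K \in [::] -> [disjoint K & I]) ->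
     ((c k \in I) && (c (k + 1.*2) \in I)) + #|I :\: W| <= 2.
    move=> sI _; have := card_setI_seq I hM; rewrite /= addn0 -[1.*2]/2.
    have := stable_edge sI mm'; have := stable_edge sI nn'; have := stable_edge sI mn.
    have := stable_edge sI km'; have := stable_edge sI kn'.
    by case: (c k \in I); case: (c (k + 2) \in I); case: (m \in I); case: (m' \in I);
      case: (n \in I); case: (n' \in I) => //= _ _ _ _ _; clear; card_lia.
  have eL : q.*2 + 3 = 1.*2.+1 + q.*2 by rewrite addnC.
  have := arc_drop e_sym Wc L2 eL q3 (isT : all (clq e) [::]) hI.
  by apply: drop3_le; move: q3; clear; lia.
apply: (@alternating_full k 2 m n) => // [|t tq|t tq].
- by apply: contraTneq un => ->; rewrite /= !inE eqxx orbT.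
- exact: near_alternating oM _ sq tq km'.
have oN := outsideT oM; apply/negP => kn.
(* The positions [0, 2, 4, 7, 9, ...] counted from [k] are now seen from [k + 2]; the first is at
   distance [2q + 1] around the cycle. *)
case: t tq kn => [|[|[|t]]] tq kn.
- rewrite -[0.*2 + _]/0 addn0 -(cL k) in kn.
  apply: (near_odd oN q2 _ kn'); first by clear; lia.
  by rewrite (_ : k + 2 + q.*2.+1 = k + (q.*2 + 3)) //; clear; lia.
- by have := tf kn kn'; rewrite nn'.
- apply: (near_even (h := 1) oN _ _ kn') => //; first by move: q3; clear; lia.
  by rewrite -addnA.
apply: (near_odd (h := t.+2) oN _ _ kn') => //; first by move: tq; clear; lia.
by move: kn; congr (is_true (e (c _) n)); rewrite /=; clear; lia.
Qed.

Lemma cross_pairs m m' n n' k : 2 < q -> outside m m' n n' ->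
  e (c k) m || e (c k) m' -> e (c (k + 2)) n || e (c (k + 2)) n' -> False.
Proof.
move=> q3 oM; have oM' := outsideC oM; have oN := outsideT (outsideC (outsideT oM)).
have oN' := outsideC oN.
case/orP => km /orP[] kn.
- exact: cross2 q3 oN' km kn.
- exact: cross2 q3 oM' km kn.
- exact: cross2 q3 oN km kn.
- exact: cross2 q3 oM km kn.
Qed.

(** By [cross_pairs], attachment to [mm'] spreads in steps of two to the whole odd cycle, and then
    no cycle vertex is joined to [n]. Since [n] cannot be joined to both [m] and [m'], its degree
    would be at most two. *)
Lemma not_all_attached m m' n n' : 2 < q -> outside m m' n n' ->
  ~ e (c 0) m || e (c 0) m'.
Proof.
move=> q3 oM m0; have [cL _ eW _ _] := Wc; have [mm' nn' un hM] := oM.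
have all_m k : e (c k) m || e (c k) m'.
  apply: (@two_step (fun k => e (c k) m || e (c k) m') c (q.*2 + 3)) => //.
  - by rewrite oddD odd_double.
  - by move=> i j ->.
  move=> i im; have [z /hM] := attach_at i.+2 Wc.
  have := @cross_pairs m m' n n' i q3 oM im; rewrite addn2 !inE => h.
  by case/or4P => /eqP->; [move=> ->|move=> ->; rewrite orbT|move=> zn; case: h; rewrite zn|move=> zn; case: h; rewrite zn orbT].
have no_n z : z \in W -> ~~ e n z.
  rewrite {1}eW => /(supportP (ltnW (ltnW L2)) cL)[k ->].
  apply/negP => nk; apply: (@cross_pairs m m' n n' (k + (q.*2 + 1)) q3 oM (all_m _)).
  by rewrite -addnA -[q.*2 + 1 + 2]addnA cL e_sym nk.
have := min_degree3 e_sym e_irr aT rT tf cT nD n.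
have sub : nb e [set n] setT \subset [set n'; if e n m then m else m'].
  apply/subsetP => z; rewrite nb1 => /andP[_ nz].
  have /hM : z \notin W by apply: contraL nz; apply: no_n.
  rewrite !inE => /or4P[]/eqP zE; rewrite zE in nz *; rewrite ?eqxx ?orbT //.
  - by rewrite nz eqxx orbT.
  - have [nm|] := boolP (e n m); last by rewrite eqxx orbT.
    by have := tf nm nz; rewrite mm'.
  by rewrite e_irr in nz.
move/leq_trans/(_ (subset_leq_card sub)); rewrite cards2.
by case: (_ != _).
Qed.

Lemma seven_cycle u v x y : q = 2 -> outside u v x y -> ~~ e u x -> ~~ e v y -> False.
Proof.
move=> eq2 oM ux vy; have [uv xy un hM] := oM.
have [cL _ _ cE _] := Wc; have [uW vW xW yW] := outside_notin oM.
pose vtx l := nth u [:: u; v; x; y] l.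
pose lab k := if e (c k) u then 0 else if e (c k) v then 1 else if e (c k) x then 2 else 3.
have lab4 k : lab k < 4 by rewrite /lab; case: ifP => // _; case: ifP => // _; case: ifP.
have labE k : e (c k) (vtx (lab k)).
  rewrite /lab; case: ifP => [//|/negbT ku]; case: ifP => [//|/negbT kv].
  case: ifP => [//|/negbT kx]; have [z /hM] := attach_at k Wc.
  by rewrite !inE => /or4P[] /eqP-> //; rewrite ?(negbTE ku) ?(negbTE kv) ?(negbTE kx).
have oX := outsideC oM; have oY := outsideT (outsideC (outsideT oM)); have oXY := outsideC oY.
have excl k l : l < 4 -> e (c k) (vtx l) -> lab k = l.
  have duv : ~~ (e (c k) u && e (c k) v).
    by apply/negP => /andP[a1 a2]; have := tf a1 a2; rewrite uv.
  have dxy : ~~ (e (c k) x && e (c k) y).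
    by apply/negP => /andP[a1 a2]; have := tf a1 a2; rewrite xy.
  have dvy : ~~ (e (c k) v && e (c k) y) by apply/negP => /andP[]; apply: cross0 oM.
  have duy : ~~ (e (c k) u && e (c k) y) by apply/negP => /andP[]; apply: cross0 oX.
  have dvx : ~~ (e (c k) v && e (c k) x) by apply/negP => /andP[]; apply: cross0 oY.
  have dux : ~~ (e (c k) u && e (c k) x) by apply/negP => /andP[]; apply: cross0 oXY.
  move: duv dxy dvy duy dvx dux; rewrite /vtx /lab; case: l => [|[|[|[|l]]]] //=.
  - by move=> _ _ _ _ _ _ _ ->.
  - by case: (e (c k) u); case: (e (c k) v).
  - by case: (e (c k) u); case: (e (c k) v); case: (e (c k) x).
  by case: (e (c k) u); case: (e (c k) v); case: (e (c k) x); case: (e (c k) y).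
have full k m n : m != n -> ~~ e m n -> m \notin W -> n \notin W ->
    has (fun i => e (c i) m || e (c i) n) [:: k; k.+2; k.+4].
  move=> mn emn mW nW; apply/negPn/negP => h.
  have hh t : t <= q -> ~~ (e (c (k + (t.*2 + (2 < t)))) m || e (c (k + (t.*2 + (2 < t)))) n).
    rewrite eq2; move: h; rewrite /= orbF !negb_or => /and3P[h1 h2 h3].
    case: t => [|[|[|t]]] // _.
    - by rewrite -[_ + nat_of_bool _]/0 addn0.
    - by rewrite -[_ + nat_of_bool _]/2 addn2.
    by rewrite -[_ + nat_of_bool _]/4 addn4.
  by apply: (@alternating_full k 2 m n) => // t /hh; rewrite negb_or => /andP[].
apply: (@no_good_labelling lab) => //.
  by move=> k; rewrite /lab; have := cL k; rewrite eq2 => ->.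
move=> k; apply/and4P; split.
- apply/eqP => lk; have := tf (cE k) (labE k).
  by rewrite lk labE.
- have near a a' b b' i : outside a a' b b' -> e (c i) a' -> e (c i.+2) a -> False.
    move=> oA ia; rewrite -addn2 => ia'.
    by apply: (@near_even a a' b b' i 1) => //; rewrite eq2.
  have h1 := labE k; have h2 := labE k.+2; rewrite /vtx in h1 h2.
  apply/negP; rewrite !inE !xpair_eqE => /or4P[] /andP[/eqP E1 /eqP E2];
    rewrite E1 /= in h1; rewrite E2 /= in h2.
  + exact: near oX h1 h2.
  + exact: near oM h1 h2.
  + exact: near (outsideC (outsideT oM)) h1 h2.
  + exact: near (outsideT oM) h1 h2.
- have ux' : u != x by apply: contraTneq un => ->; rewrite /= !inE eqxx orbT.
  have /hasP[i ik /orP[] h] := full k u x ux' ux uW xW; apply/hasP; exists i => //.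
    by rewrite (excl i 0).
  by rewrite (excl i 2).
have vy' : v != y by apply: contraTneq un => ->; rewrite /= !inE eqxx ?orbT ?andbF.
have /hasP[i ik /orP[] h] := full k v y vy' vy vW yW; apply/hasP; exists i => //.
  by rewrite (excl i 1).
by rewrite (excl i 3).
Qed.
End FourOutside.

Lemma extremal_contradiction : False.
Proof.
have [S [_ _ /(leq_trans (ltn0Sn _))/card_gt0P[u _]]] := stableT rT (clq0 e).
have [v uv _] := nbr_other e_sym e_irr aT rT u u.
pose R := setT :\: [set u; v].
have [/existsP[K /and3P[cK KR aK]]|] :=
    boolP [exists K : {set T}, [&& clq e K, K \subset R & alpha_le e (R :\: K) q.+1]]; last first.
  rewrite negb_exists => /forallP h; apply: (edge_rest_not_robust uv) => K cK KR.
  by have := h K; rewrite cK KR.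
have nR := noiso_edge e_sym e_irr aT rT tf uv.
(* A clique of a triangle-free graph has at most two vertices, and it extends to an edge because [R]
   has no isolated vertex. *)
have [x [y [xR yR xy Kxy]]] : exists x y, [/\ x \in R, y \in R, e x y & K \subset [set x; y]].
  have [K0|/set0Pn[x xK]] := eqVneq K set0.
    have /set0Pn[x xR] := noiso_neq0 rT (clq2 e_sym uv) (erefl R).
    have [y yR xy] := nR x xR.
    by exists x, y; split=> //; rewrite K0 sub0set.
  have xR := subsetP KR _ xK.
  have [K1|] := boolP (K \subset [set x]).
    have [y yR xy] := nR x xR; exists x, y; split=> //.
    by apply: subset_trans K1 _; rewrite sub1set !inE eqxx.
  case/subsetPn => y yK; rewrite inE => yx; have yR := subsetP KR _ yK.
  move/clqP: cK => cK; have xy : e x y by apply: cK; rewrite // eq_sym.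
  exists x, y; split=> //; apply/subsetP => z zK; rewrite !inE.
  apply/norP => -[zx zy]; have := tf xy (cK x z xK zK _).
  by rewrite (cK y z) // eq_sym // => /(_ zx).
pose W := R :\: [set x; y].
have aW : alpha_le e W q.+1 by apply: alpha_leS aK => //; apply: setDS.
have rW := rest_robust e_sym nD uv (clq2 e_sym xy) aW.
have cW : #|W| = q.*2 + 3.
  by rewrite (card_edge e_irr xy) // (card_edge e_irr uv) ?inE // cardsT cT; clear; card_lia.
have [c Wc] := robust_odd_cycle e_sym e_irr aW rW cW.
have oM : outside W u v x y.
  split=> //.
    rewrite /= !inE !negb_or (edge_neq e_irr uv) (edge_neq e_irr xy).
    rewrite (eq_sym u x) (eq_sym u y) (eq_sym v x) (eq_sym v y).
    by move: xR yR; rewrite !inE !negb_or !andbT => /andP[-> ->] /andP[-> ->].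
  by move=> z; rewrite !inE !andbT negb_and !negbK => /orP[/orP[]->|/orP[]->]; rewrite ?orbT.
have [q3|q3] := ltnP 2 q.
  have [_ _ _ hM] := oM; have [m /hM] := attach_at 0 Wc.
  rewrite !inE => /or4P[]/eqP-> h.
  - by apply: (not_all_attached Wc q3 oM); rewrite h.
  - by apply: (not_all_attached Wc q3 oM); rewrite h orbT.
  - by apply: (not_all_attached Wc q3 (outsideT oM)); rewrite h.
  - by apply: (not_all_attached Wc q3 (outsideT oM)); rewrite h orbT.
have eq2 : q = 2 by apply/eqP; rewrite eqn_leq q3.
have oN := outsideT (outsideC (outsideT oM)).
(* Triangle-freeness allows [x] and [y] to be named so that [ux] and [vy] are not edges. *)
have [ux|ux] := boolP (e u x).
  apply: (seven_cycle Wc eq2 oN); first by apply: contraL xy => uy; apply: tf ux uy.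
  by rewrite e_sym; apply: contraL uv => xv; apply: (tf (x := x)) => //; rewrite e_sym.
have [vy|vy] := boolP (e v y); last by apply: (seven_cycle Wc eq2 oM).
apply: (seven_cycle Wc eq2 oN).
  by rewrite e_sym; apply: contraL uv => yu; apply: (tf (x := y)) => //; rewrite e_sym.
by apply: contraL xy => vx; apply: tf vx vy.
Qed.
End Extremal.

(** * Transfer between graphs *)

Lemma robust_card_bound (T : finType) (e : rel T) (a r : nat) :
  symmetric e -> irreflexive e -> 1 < a ->
  alpha_le e setT (a + r).+2 -> robust e setT (a + r).+1 ->
  ~ drop e r.+3 setT a -> a.*2 + r + 7 < #|T|.
Proof.
move=> e_sym e_irr a1 aT rT nD; rewrite ltnNge; apply/negP => nT.
have [/existsP[x /existsP[y /existsP[z /and3P[xy xz yz]]]]|ntf] :=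
    boolP [exists x, exists y, exists z, [&& e x y, e x z & e y z]].
  apply: nD; apply: (triangle_drop e_sym e_irr aT rT xy yz xz) => //.
  by rewrite !addnS.
have tf x y z : e x y -> e x z -> ~~ e y z.
  move=> xy xz; apply/negP => yz; case/existsP: ntf; exists x.
  by apply/existsP; exists y; apply/existsP; exists z; rewrite xy xz yz.
case: r aT rT nT nD => [|r] aT rT nT nD.
  rewrite addn0 in aT; rewrite addn0 in rT; rewrite addn0 in nT.
  have [cT|cT] := leqP #|T| (a.*2 + 6).
    exact: nD (sparse_drop3 e_sym e_irr aT rT tf cT).
  have {}cT : #|T| = a.*2 + 7 by apply/eqP; rewrite eqn_leq nT addnS cT.
  exact: (extremal_contradiction e_sym e_irr aT rT tf cT a1 nD).
(* Three edges gain two units and leave at most [2a + r + 2 = 2a + r.+1 + 1] vertices, enough for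
   the [r.+1] cliques still allowed. *)
apply: (no_edge_drop3 e_sym e_irr aT rT tf) => [[u [v [x [y [uv xW yW xy]]]]]||].
- case=> z [w [zR wR zw aR]]; apply: nD.
  apply: (drop_cons (clq2 e_sym uv)); apply: (drop_cons (clq2 e_sym xy)).
  apply: (drop_cons (clq2 e_sym zw)); apply: multi_drop => //.
  rewrite (card_edge e_irr zw zR wR) (card_edge e_irr xy xW yW).
  rewrite (card_edge e_irr uv) ?inE // cardsT.
  by move: nT; clear; card_lia.
- by move: a1; clear; lia.
by move: nT; clear; card_lia.
Qed.

Section DropTransfer.
Variables (T1 T2 : finType) (e1 : rel T1) (e2 : rel T2) (f : T1 -> T2).
Hypothesis f_inj : injective f.
Hypothesis f_rel : forall x y, e2 (f x) (f y) = e1 x y.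

Lemma in_foldl_setD (T : finType) (X : {set T}) Ks x :
  (x \in foldl (@setD T) X Ks) = (x \in X) && ~~ has (fun K : {set T} => x \in K) Ks.
Proof.
by elim: Ks X => [|K Ks IH] X /=; rewrite ?andbT // IH in_setD negb_or andbCA andbA.
Qed.

Lemma imset_stable (S : {set T1}) : stable e2 (f @: S) = stable e1 S.
Proof.
apply/stableP/stableP => h x y.
  by move=> xS yS; rewrite -f_rel; apply: h; apply: imset_f.
by move=> /imsetP[x' xS ->] /imsetP[y' yS ->]; rewrite f_rel h.
Qed.

Lemma preimset_clq (K : {set T2}) : clq e2 K -> clq e1 (f @^-1: K).
Proof.
move=> /clqP cK; apply/clqP => x y; rewrite !inE => xK yK xy.
by rewrite -f_rel; apply: cK; rewrite ?(inj_eq f_inj).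
Qed.

Lemma alpha_le_preimset (X : {set T2}) a : alpha_le e2 X a -> alpha_le e1 (f @^-1: X) a.
Proof.
move=> /alpha_leP h; apply/alpha_leP => S sS SX.
rewrite -(card_imset _ f_inj); apply: h; first by rewrite imset_stable.
by apply/subsetP => _ /imsetP[x /(subsetP SX) + ->]; rewrite inE.
Qed.

Lemma preimset_foldl (X : {set T2}) Ks :
  foldl (@setD T1) (f @^-1: X) [seq f @^-1: K | K : {set T2} <- Ks] =
  f @^-1: foldl (@setD T2) X Ks.
Proof. by elim: Ks X => [|K Ks IH] X //=; rewrite -preimsetD IH. Qed.

Lemma drop_preimset k (X : {set T2}) a : drop e2 k X a -> drop e1 k (f @^-1: X) a.
Proof.
case=> Ks [sK cK aK]; exists [seq f @^-1: K | K : {set T2} <- Ks]; split.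
- by rewrite size_map.
- by apply/allP => _ /mapP[K /(allP cK) + ->]; apply: preimset_clq.
by rewrite preimset_foldl; apply: alpha_le_preimset.
Qed.
End DropTransfer.

Lemma drop_sub_type (T : finType) (e : rel T) (W : {set T}) k a :
  drop (fun x y : {x | x \in W} => e (val x) (val y)) k setT a -> drop e k W a.
Proof.
case=> Ks [sK cK /alpha_leP aK]; exists [seq val @: K | K : {set {x | x \in W}} <- Ks]; split.
- by rewrite size_map.
- apply/allP => _ /mapP[K /(allP cK)/clqP cK' ->]; apply/clqP => _ _ /imsetP[x xK ->] /imsetP[y yK ->] xy.
  by apply: cK' => //; apply: contraNneq xy => ->.
apply/alpha_leP => S sS SW; pose S' := [set x : {x | x \in W} | val x \in S].
have eS : S = val @: S'.
  apply/setP => x; apply/idP/imsetP => [xS|[y + ->]]; last by rewrite inE.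
  have := subsetP SW _ xS; rewrite in_foldl_setD => /andP[xW _].
  by exists (exist _ x xW); rewrite ?inE.
rewrite eS card_imset; last exact: val_inj.
apply: aK.
  move/stableP: sS => sS; apply/stableP => x y; rewrite !inE; exact: sS.
apply/subsetP => x; rewrite inE => xS.
have := subsetP SW _ xS; rewrite !in_foldl_setD inE => /andP[_].
apply: contra => /hasP[K KKs xK]; apply/hasP; exists (val @: K); last exact: imset_f.
by apply/mapP; exists K.
Qed.

Section Folkman.

(* [folkman r p e] says that the complement [G] of [e] satisfies
   [G -> (2_r, p)] and [omega(G) < r + p - 1]; see [admissible_folkman]. *)
Definition folkman (T : finType) r p (e : rel T) :=
  [/\ symmetric e, irreflexive e, alpha_le e setT (r + p - 2) &
      ~ drop e r setT p.-1].

(** A clique through the isolated [None] is that vertex alone, and the other [r] cliques would do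
    for [e]. If [None] survives, the surviving part of [e] is brought down to [p.-2], and one of the
    cliques can be spared. *)
Lemma folkman_isolated (T : finType) r p (e : rel T) : 1 < p ->
  folkman r p e ->
  folkman r.+1 p (fun x y : option T =>
    if (x, y) is (Some x', Some y') then e x' y' else false).
Proof.
move=> p1 [e_sym e_irr aT nD]; set e' := fun _ _ => _.
have sj : injective (@Some T) by move=> x y [].
have fE x y : e' (Some x) (Some y) = e x y by [].
have cS (S : {set option T}) : #|S| = (None \in S) + #|Some @^-1: S|.
  rewrite (cardsD1 None S) -(card_imset (Some @^-1: S) sj).
  congr (_ + #|pred_of_set _|); apply/setP => -[x|].
    by rewrite !inE mem_imset ?inE //; exact: sj.
  by rewrite !inE; apply/esym/imsetP => -[].
split.
- by case=> [x|] [y|] //=.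
- by case=> [x|] //=.
- apply/alpha_leP => S sS _; rewrite cS.
  have -> : r.+1 + p - 2 = (r + p - 2).+1 by lia.
  rewrite -add1n leq_add //; first by case: (_ \in _).
  move/alpha_leP: aT; apply; rewrite ?subsetT //.
  move/stableP: sS => sS; apply/stableP => x y; rewrite !inE; exact: sS.
case=> Ks [sK cK aK]; apply: nD.
have [/hasP[K KKs NK]|nN] := boolP (has (fun K : {set option T} => None \in K) Ks).
  have K1 x : Some x \notin K.
    by apply/negP => xK; have /clqP/(_ _ _ NK xK isT) := allP cK _ KKs.
  exists [seq Some @^-1: K' | K' : {set option T} <- rem K Ks]; split.
  - by rewrite size_map size_rem // sK.
  - apply/allP => _ /mapP[K' /mem_rem/(allP cK) + ->].
    exact: (preimset_clq sj fE).
  have := alpha_le_preimset sj fE aK; congr (is_true (alpha_le e _ _)).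
  apply/setP => x; rewrite in_set !in_foldl_setD !inE; congr (~~ _).
  rewrite has_map (perm_has _ (perm_to_rem KKs)) /= (negbTE (K1 x)) /=.
  by apply: eq_has => K'; rewrite /= inE.
case: Ks sK cK aK nN => // K Ks [sK] /= /andP[cK cKs] /alpha_leP aK nN.
have {}aK : alpha_le e (foldl (@setD T) setT [seq Some @^-1: K' | K' : {set option T} <- Ks] :\: Some @^-1: K) p.-2.
  apply/alpha_leP => S sS SW; pose S' : {set option T} := None |: Some @: S.
  have nS : None \notin Some @: S by apply/imsetP => -[].
  suff : #|S'| <= p.-1 by rewrite cardsU1 nS card_imset; [lia|exact: sj].
  apply: aK.
    move/stableP: sS => sS; apply/stableP => x y; rewrite !inE.
    case/orP => [/eqP->|/imsetP[x' xS ->]]; first by [].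
    case/orP => [/eqP->|/imsetP[y' yS ->]]; first by [].
    exact: sS.
  apply/subsetP => x; rewrite in_foldl_setD !inE andbT.
  case/orP => [/eqP->|/imsetP[x' xS ->]].
    by move: nN; rewrite negb_or.
  have := subsetP SW _ xS; rewrite !inE in_foldl_setD inE /= => /andP[-> h].
  by apply: contra h => /hasP[K' K'Ks xK']; apply/hasP; exists (Some @^-1: K'); rewrite ?inE ?map_f.
exists [seq Some @^-1: K' | K' : {set option T} <- Ks]; split.
- by rewrite size_map.
- by apply/allP => _ /mapP[K' /(allP cKs) + ->]; apply: (preimset_clq sj fE).
have -> : p.-1 = p.-2.+1 by lia.
exact: clq_drop (preimset_clq sj fE cK) aK.
Qed.

(** Stability numbers add over a disjoint union, before and after the removal of cliques. The bound
    [r + p - 2] is additive in [p] exactly for [r = 2]. This builds witnesses for large [p]. *)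
Lemma folkman_union (T1 T2 : finType) p1 p2 (e1 : rel T1) (e2 : rel T2) :
  0 < p1 -> 0 < p2 ->
  folkman 2 p1 e1 -> folkman 2 p2 e2 ->
  folkman 2 (p1 + p2) (fun x y : T1 + T2 =>
    match x, y with inl x', inl y' => e1 x' y' | inr x', inr y' => e2 x' y' | _, _ => false end).
Proof.
move=> p10 p20 [s1 i1 a1 d1] [s2 i2 a2 d2]; set e := fun _ _ => _.
have f1 x y : e (inl x) (inl y) = e1 x y by [].
have f2 x y : e (inr x) (inr y) = e2 x y by [].
have j1 : injective (@inl T1 T2) by move=> x y [].
have j2 : injective (@inr T1 T2) by move=> x y [].
have dis (S1 : {set T1}) (S2 : {set T2}) : [disjoint inl @: S1 & inr @: S2].
  by rewrite -setI_eq0; apply/eqP/setP => z; rewrite !inE; apply/negP => /andP[/imsetP[x _ ->] /imsetP[]].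
have cU (S1 : {set T1}) (S2 : {set T2}) : #|inl @: S1 :|: inr @: S2| = #|S1| + #|S2|.
  by rewrite cardsU (disjoint_setI0 (dis _ _)) cards0 subn0 !card_imset.
split.
- by case=> [x|x] [y|y] //=.
- by case=> [x|x] //=.
- apply/alpha_leP => S sS _.
  have -> : S = inl @: (inl @^-1: S) :|: inr @: (inr @^-1: S).
    apply/setP => -[x|x]; rewrite !inE.
      rewrite mem_imset // inE; case: (inl x \in S) => //=.
      by apply/esym/imsetP => -[].
    rewrite orbC mem_imset // inE; case: (inr x \in S) => //=.
    by apply/esym/imsetP => -[].
  move/stableP: sS => sS; rewrite cU.
  have -> : 2 + (p1 + p2) - 2 = (2 + p1 - 2) + (2 + p2 - 2) by lia.
  apply: leq_add; [move/alpha_leP: a1|move/alpha_leP: a2]; apply; rewrite ?subsetT //.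
    by apply/stableP => x y; rewrite !inE; apply: sS.
  by apply/stableP => x y; rewrite !inE; apply: sS.
case=> Ks [sK cK /alpha_leP aK].
have [S1 [sS1 S1W cS1]] : exists S1 : {set T1}, [/\ stable e1 S1,
    S1 \subset inl @^-1: foldl (@setD _) setT Ks & p1.-1 < #|S1|].
  apply/alpha_leNP/negP => h; apply: d1.
  exists [seq inl @^-1: K | K : {set T1 + T2} <- Ks]; split; rewrite ?size_map //.
    by apply/allP => _ /mapP[K /(allP cK) + ->]; apply: (preimset_clq j1 f1).
  by have := preimset_foldl (@inl T1 T2) setT Ks; rewrite preimsetT => ->.
have [S2 [sS2 S2W cS2]] : exists S2 : {set T2}, [/\ stable e2 S2,
    S2 \subset inr @^-1: foldl (@setD _) setT Ks & p2.-1 < #|S2|].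
  apply/alpha_leNP/negP => h; apply: d2.
  exists [seq inr @^-1: K | K : {set T1 + T2} <- Ks]; split; rewrite ?size_map //.
    by apply/allP => _ /mapP[K /(allP cK) + ->]; apply: (preimset_clq j2 f2).
  by have := preimset_foldl (@inr T1 T2) setT Ks; rewrite preimsetT => ->.
have := aK (inl @: S1 :|: inr @: S2); rewrite cU => h.
suff : #|S1| + #|S2| <= (p1 + p2).-1 by move: cS1 cS2 p10 p20; clear; card_lia.
apply: h.
  move/stableP: sS1 => sS1; move/stableP: sS2 => sS2.
  apply/stableP => x y; rewrite !inE.
  by case/orP => /imsetP[x' xS ->] /orP[] /imsetP[y' yS ->] //=; [apply: sS1|apply: sS2].
rewrite subUset; apply/andP; split; apply/subsetP => _ /imsetP[x xS ->].
  by have := subsetP S1W _ xS; rewrite inE.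
by have := subsetP S2W _ xS; rewrite inE.
Qed.
End Folkman.

(** * Folkman numbers *)

Definition compl (T : finType) (E : rel T) : rel T := fun x y => (x != y) && ~~ E x y.

Lemma compl_irr (T : finType) (E : rel T) : irreflexive (compl E).
Proof. by move=> x; rewrite /compl eqxx. Qed.

Lemma compl_sym (T : finType) (E : rel T) : symmetric E -> symmetric (compl E).
Proof. by move=> sE x y; rewrite /compl sE eq_sym. Qed.

Lemma is_clique_stable n (E : rel 'I_n) (S : {set 'I_n}) : is_clique E S = stable (compl E) S.
Proof.
apply: eq_forallb => x; congr (_ ==> _); apply: eq_forallb => y; congr (_ ==> _).
by rewrite /compl negb_and !negbK implybE negbK.
Qed.

Lemma clique_num_ltE n (E : rel 'I_n) q :
  clique_num_lt E q.+1 <-> alpha_le (compl E) setT q.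
Proof.
split=> [h|/alpha_leP h S]; last by rewrite is_clique_stable => /h; apply; rewrite subsetT.
by apply/alpha_leP => S sS _; rewrite -ltnS; apply: h; rewrite is_clique_stable.
Qed.

Lemma size_twos_p r p : size (twos_p r p) = r.+1.
Proof. by rewrite size_cat size_nseq addn1. Qed.

Lemma nth_twos_p r p i : nth 0 (twos_p r p) i = if i < r then 2 else nth 0 [:: p] (i - r).
Proof. by rewrite nth_cat size_nseq nth_nseq; case: (i < r). Qed.

(** Each vertex gets as colour the index of the first removed clique containing it; [find] returns
    [size Ks], the last colour, on the surviving vertices. *)
Lemma arrows_no_drop n (E : rel 'I_n) r p : simple_graph E -> 0 < p ->
  vertex_arrows E (twos_p r p) -> ~ drop (compl E) r setT p.-1.
Proof.
move=> [iE sE] p0 arr [Ks [sK cK /alpha_leP aK]].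
pose col (x : 'I_n) := find (fun K : {set 'I_n} => x \in K) Ks.
have colP x : col x < size (twos_p r p) by rewrite size_twos_p ltnS -sK find_size.
have [i [S [cS]]] := arr (fun x => Ordinal (colP x)).
rewrite nth_twos_p => nS iS; rewrite is_clique_stable in cS.
have {}iS x : x \in S -> col x = i by move/iS/(congr1 val).
case: ltnP nS => [ir|ri] nS.
  pose K := nth set0 Ks i.
  have KKs : K \in Ks by rewrite mem_nth // sK.
  have SK : S \subset K.
    apply/subsetP => x xS; rewrite /K -(iS x xS) /col.
    by apply: (@nth_find _ set0 (fun K : {set 'I_n} => x \in K)); rewrite has_find -/(col x) iS // sK.
  have := clq_stable (allP cK _ KKs) cS.
  by rewrite (setIidPr SK) nS.
have ir : i = r :> nat by apply/eqP; rewrite eqn_leq ri andbT -ltnS -(size_twos_p r p).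
rewrite ir subnn /= in nS.
have : S \subset foldl (@setD _) setT Ks.
  apply/subsetP => x /iS xi; rewrite in_foldl_setD inE /=.
  by rewrite has_find -/(col x) xi ir sK ltnn.
by move/(aK _ cS); rewrite nS; move: p0; clear; lia.
Qed.

Lemma subset_of_size (T : finType) (S : {set T}) m : m <= #|S| ->
  exists2 S' : {set T}, S' \subset S & #|S'| = m.
Proof.
move=> mS; exists [set x in take m (enum S)].
  by apply/subsetP => x; rewrite inE => /mem_take; rewrite mem_enum.
rewrite cardsE; have /card_uniqP-> : uniq (take m (enum S)) by rewrite take_uniq ?enum_uniq.
by rewrite size_takel // -cardE.
Qed.

Lemma no_drop_arrows n (E : rel 'I_n) r p : simple_graph E -> 0 < p ->
  ~ drop (compl E) r setT p.-1 -> vertex_arrows E (twos_p r p).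
Proof.
move=> [iE sE] p0 nD c.
have [/existsP[i /existsP[S /and3P[cS /eqP nS /forall_inP cl]]]|none] :=
    boolP [exists i : 'I_(size (twos_p r p)), exists S : {set 'I_n},
      [&& is_clique E S, #|S| == nth 0 (twos_p r p) i & [forall x in S, c x == i]]].
  by exists i, S; split=> // x xS; apply/eqP/cl.
have {}none (i : 'I_(size (twos_p r p))) (S : {set 'I_n}) : is_clique E S ->
    #|S| = nth 0 (twos_p r p) i -> (forall x, x \in S -> c x = i) -> False.
  move=> cS nS cl; case/negP: none; apply/existsP; exists i; apply/existsP; exists S.
  by rewrite cS nS eqxx; apply/forall_inP => x /cl/eqP.
case: nD; exists [seq [set x | c x == i :> nat] | i <- iota 0 r]; split.
- by rewrite size_map size_iota.
- apply/allP => _ /mapP[i + ->]; rewrite mem_iota add0n => /andP[_ ir].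
  have iP : i < size (twos_p r p) by rewrite size_twos_p ltnS ltnW.
  apply/clqP => x y; rewrite !inE => /eqP xi /eqP yi xy; rewrite /compl xy /=.
  apply/negP => Exy; apply: (none (Ordinal iP) [set x; y]).
  - rewrite is_clique_stable; apply/stableP => u v; rewrite /compl !inE.
    by move=> /orP[]/eqP-> /orP[]/eqP->; rewrite ?eqxx // ?Exy ?[E y x]sE ?Exy andbF.
  - by rewrite nth_twos_p /= ir cards2 xy.
  by move=> z; rewrite !inE => /orP[]/eqP->; apply: val_inj.
apply/alpha_leP => S sS SW; rewrite leqNgt; apply/negP => pS.
have [|S' S'S cS'] := @subset_of_size _ S p; first by rewrite -(prednK p0).
have rP : r < size (twos_p r p) by rewrite size_twos_p.
apply: (none (Ordinal rP) S'); first by rewrite is_clique_stable; apply: stableS sS.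
  by rewrite nth_twos_p /= ltnn subnn.
move=> x /(subsetP S'S)/(subsetP SW); rewrite in_foldl_setD inE /= => /hasPn h.
apply: val_inj => /=; apply/eqP; have := ltn_ord (c x); rewrite {2}size_twos_p ltnS.
rewrite leq_eqVlt => /orP[//|cr]; have := h [set y | c y == c x :> nat].
rewrite inE eqxx => /(_ (map_f _ _)); rewrite mem_iota cr; by case/(_ isT).
Qed.

Lemma admissible_folkman r p n : 0 < r -> 0 < p ->
  Fv_admissible (twos_p r p) (r + p - 1) n ->
  exists e : rel 'I_n, folkman r p e.
Proof.
move=> r0 p0 [E [sE aE cE]]; exists (compl E); split.
- by case: sE => _; apply: compl_sym.
- exact: compl_irr.
- by apply/clique_num_ltE; have -> : (r + p - 2).+1 = r + p - 1 by lia.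
exact: arrows_no_drop.
Qed.

Lemma folkman_admissible (T : finType) r p (e : rel T) : 0 < r -> 0 < p ->
  folkman r p e -> Fv_admissible (twos_p r p) (r + p - 1) #|T|.
Proof.
move=> r0 p0 [e_sym e_irr aT nD].
pose E (i j : 'I_#|T|) := (i != j) && ~~ e (enum_val i) (enum_val j).
have cE i j : compl E i j = e (enum_val i) (enum_val j).
  rewrite /compl /E; have [->|ij] := eqVneq i j; first by rewrite e_irr.
  by rewrite negbK.
have sE : simple_graph E.
  by split=> [i|i j]; rewrite /E ?eqxx // eq_sym e_sym.
exists E; split=> //.
  apply: no_drop_arrows => // d; apply: nD.
  have rE x y : compl E (enum_rank x) (enum_rank y) = e x y by rewrite cE !enum_rankK.
  by have := drop_preimset enum_rank_inj rE d; rewrite preimsetT.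
have -> : r + p - 1 = (r + p - 2).+1 by lia.
apply/clique_num_ltE.
have rE i j : e (enum_val i) (enum_val j) = compl E i j by rewrite cE.
by have := alpha_le_preimset enum_val_inj rE aT; rewrite preimsetT.
Qed.

Lemma Fv_spec a q : (exists n, Fv_admissible a q n) ->
  Fv_admissible a q (Fv a q) /\ forall m, Fv_admissible a q m -> Fv a q <= m.
Proof.
case=> n0 an0.
apply: (epsilon_spec (inhabits 0)
  (fun n => Fv_admissible a q n /\ forall m, Fv_admissible a q m -> n <= m)).
pose P n : bool := if excluded_middle_informative (Fv_admissible a q n) then true else false.
have PP n : reflect (Fv_admissible a q n) (P n).
  by rewrite /P; case: excluded_middle_informative => h; constructor.
have exP : exists n, P n by exists n0; apply/PP.
by exists (ex_minn exP); case: ex_minnP => n /PP an hn; split=> // m /PP; apply: hn.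
Qed.

(** * Small graphs *)

Section ColouringSearch.
Variable J : seq nat.
Hypothesis J0 : 0 \notin J.

(** With truncated subtraction the sum is the distance of [x] and [y]. The graph on [n] vertices is
    circulant when [J] is stable under [j] to [n - j]. *)
Definition dist_adj x y := (x - y) + (y - x) \in J.

Lemma dist_adj_sym : symmetric dist_adj.
Proof. by move=> x y; rewrite /dist_adj addnC. Qed.

Lemma dist_adj_irr : irreflexive dist_adj.
Proof. by move=> x; rewrite /dist_adj subnn (negbTE J0). Qed.

Fixpoint has_clique k l :=
  if k is k'.+1 then has (fun x => has_clique k' (filter (dist_adj x) l)) l else true.

Lemma has_cliqueP k l :
  reflect (exists s, [/\ size s = k, {subset s <= l} & pairwise dist_adj s]) (has_clique k l).
Proof.
elim: k l => [|k IHk] l /=; first by constructor; exists [::].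
apply: (iffP hasP) => [[x xl /IHk[s [ss sl ps]]]|[[|x s] []] //= [ss] sl /andP[px ps]].
  exists (x :: s); split; rewrite /= ?ss ?ps ?andbT //.
    by move=> y; rewrite inE => /orP[/eqP->//|/sl]; rewrite mem_filter => /andP[].
  by apply/allP => y /sl; rewrite mem_filter => /andP[].
exists x; first by apply: sl; rewrite mem_head.
apply/IHk; exists s; split=> // y ys.
by rewrite mem_filter (allP px) // sl // inE ys orbT.
Qed.

Variable p : nat.

(* Vertices [0 .. v - 1] are coloured by the classes [A], [B], [C]; no extension
   to [v + m] vertices keeps [A], [B] stable and [C] without [p.+1]-clique.
   The conditionals prune the search under call-by-value evaluation. *)
Fixpoint no_colouring m v A B C :=
  if m is m'.+1 then
    [&& if has (dist_adj v) A then true else no_colouring m' v.+1 (v :: A) B C,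
        if has (dist_adj v) B then true else no_colouring m' v.+1 A (v :: B) C &
        if has_clique p (filter (dist_adj v) C) then true
        else no_colouring m' v.+1 A B (v :: C)]
  else false.

Lemma no_colouringP m v A B C (col : nat -> nat) : no_colouring m v A B C ->
  (forall x, col x < 3) ->
  (forall x, x \in A -> x < v /\ col x = 0) -> (forall x, x \in B -> x < v /\ col x = 1) ->
  (forall x, x \in C -> x < v /\ col x = 2) ->
  (exists x y, [/\ x < v + m, y < v + m, dist_adj x y, col x = col y & col x < 2]) \/
  (exists s, [/\ size s = p.+1, forall x, x \in s -> x < v + m /\ col x = 2 & pairwise dist_adj s]).
Proof.
move=> + col3; elim: m v A B C => //= m IHm v A B C /and3P[hA hB hC] cA cB cC.
have vv : v < v + m.+1 by rewrite addnS ltnS leq_addr.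
have lt x : x < v -> x < v + m.+1 by move=> xv; apply: ltn_trans xv vv.
have ext X i : (forall x, x \in X -> x < v /\ col x = i) ->
    (forall x, x \in X -> x < v.+1 /\ col x = i).
  by move=> h x /h[xv ->]; split=> //; apply: ltnW.
have ext1 X i : (forall x, x \in X -> x < v /\ col x = i) -> col v = i ->
    (forall x, x \in v :: X -> x < v.+1 /\ col x = i).
  by move=> h vi x; rewrite inE => /orP[/eqP->//|]; apply: ext.
rewrite -addSnnS.
case cv: (col v) (col3 v) => [|[|[|c]]] // _.
- case/orP: (hA : _ || _) => [/hasP[x xA vx]|/IHm]; last by apply; [apply: ext1|apply: ext|apply: ext].
  have [xv x0] := cA x xA.
  by left; exists v, x; rewrite cv x0 addSnnS; split=> //; apply: lt.
- case/orP: (hB : _ || _) => [/hasP[x xB vx]|/IHm]; last by apply; [apply: ext|apply: ext1|apply: ext].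
  have [xv x0] := cB x xB.
  by left; exists v, x; rewrite cv x0 addSnnS; split=> //; apply: lt.
case/orP: (hC : _ || _) => [/has_cliqueP[s [ss sl ps]]|/IHm]; last by apply; [apply: ext|apply: ext|apply: ext1].
right; exists (v :: s); rewrite /= ss ps andbT addSnnS; split=> //.
  move=> x; rewrite inE => /orP[/eqP->//|/sl]; rewrite mem_filter => /andP[_ /cC[xv ->]].
  by split=> //; apply: lt.
by apply/allP => x /sl; rewrite mem_filter => /andP[].
Qed.

Lemma search_admissible n : no_colouring n.+1 0 [::] [::] [::] ->
  ~~ has_clique p.+2 (iota 0 n.+1) -> Fv_admissible (twos_p 2 p.+1) p.+2 n.+1.
Proof.
move=> nc nq; pose E : rel 'I_n.+1 := fun i j => dist_adj i j.
have clqE (s : seq nat) : {subset s <= gtn n.+1} -> pairwise dist_adj s ->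
    is_clique E [set i : 'I_n.+1 | (i : nat) \in s] /\ #|[set i : 'I_n.+1 | (i : nat) \in s]| = size s.
  move=> sn ps; have us : uniq s by apply: pairwise_uniq ps; apply: dist_adj_irr.
  split.
    apply/forall_inP => i; rewrite inE => is_; apply/forall_inP => j; rewrite inE => js.
    apply/implyP => ij; rewrite /E.
    have : (i : nat) != j by [].
    elim: s {sn us} ps is_ js => //= x s IHs /andP[px ps]; rewrite !inE.
    case/orP => [/eqP->|is_] /orP[/eqP->|js] ij'; first by rewrite eqxx in ij'.
    - exact: (allP px).
    - by rewrite dist_adj_sym; apply: (allP px).
    exact: IHs.
  rewrite -(size_map (@inord n)) -(card_uniqP _); last first.
    rewrite map_inj_in_uniq // => x y /sn xn /sn yn /(congr1 val).
    by rewrite /= !inordK.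
  apply: eq_card => i; rewrite inE; apply/idP/mapP => [is_|[x xs ->]].
    by exists (i : nat); rewrite ?inord_val.
  by rewrite inordK //; apply: sn.
exists E; split.
- by split=> [i|i j]; [apply: dist_adj_irr|apply: dist_adj_sym].
- move=> c; pose col x : nat := c (inord x).
  have col3 x : col x < 3 by apply: ltn_ord.
  case: (no_colouringP nc col3 _ _ _) => // [[x [y [xn yn xy cxy c2]]]|[s [ss sc ps]]].
    exists (c (inord x)), [set i : 'I_n.+1 | (i : nat) \in [:: x; y]].
    have [||cS nS] := clqE [:: x; y]; rewrite /= ?xy //.
      by move=> z; rewrite !inE => /orP[]/eqP->.
    rewrite nS; split=> //.
      by move: c2; rewrite nth_twos_p => ->.
    move=> i; rewrite !inE => /orP[]/eqP ei; rewrite -[i]inord_val ei //.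
    by apply: val_inj; rewrite /= -/(col y) -cxy.
  have s0 : (c (inord (head 0 s)) : nat) = 2.
    by case: s ss sc {ps} => //= x s _ /(_ x (mem_head _ _))[].
  exists (c (inord (head 0 s))), [set i : 'I_n.+1 | (i : nat) \in s].
  have [|cS nS] := clqE s _ ps; first by move=> z /sc[].
  rewrite nS ss; split=> //; first by rewrite nth_twos_p s0.
  move=> i; rewrite inE => /sc[_ ci]; apply: val_inj; rewrite /= s0.
  by move: ci; rewrite /col inord_val.
move=> S cS; rewrite ltnNge; apply/negP => /subset_of_size[S' S'S cS'].
case/negP: nq; apply/has_cliqueP; exists (map (@nat_of_ord n.+1) (enum S')); split.
- by rewrite size_map -cardE.
- by move=> _ /mapP[i _ ->]; rewrite mem_iota ltn_ord.
rewrite pairwise_map; have := enum_uniq S'; rewrite uniq_pairwise.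
apply: (sub_in_pairwise (P := mem S')); last by apply/allP => i; rewrite mem_enum.
move=> i j /(subsetP S'S) iS /(subsetP S'S) jS ij.
by move/forall_inP: cS => /(_ i iS)/forall_inP/(_ j jS)/implyP; apply.
Qed.
End ColouringSearch.

(** * At most nine vertices: 3-colouring triangle-free graphs, read in the complement *)

Lemma handshake (T : finType) (g : rel T) (W : {set T}) :
  symmetric g -> irreflexive g -> ~~ odd (\sum_(x in W) #|[set y in W | g x y]|).
Proof.
move=> gs gi.
have [n] := ubnP #|W|; elim: n W => // n IHn W; rewrite ltnS => cW.
have [->|/set0Pn[x xW]] := eqVneq W set0; first by rewrite big_set0.
have eW z : #|[set y in W | g z y]| = g z x + #|[set y in W :\ x | g z y]|.
  rewrite (cardsD1 x) !inE xW; congr (_ + #|pred_of_set _|).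
  by apply/setP => y; rewrite !inE andbA.
rewrite (big_setD1 x) //= eW gi add0n.
under eq_bigr => z zW do rewrite eW.
rewrite big_split /= addnA oddD negb_add.
rewrite [X in odd X](_ : _ = (#|[set y in W :\ x | g x y]|).*2).
  rewrite odd_double eq_sym; have := IHn (W :\ x).
  rewrite (cardsD1 x) xW in cW; move/(_ cW).
  by case: (odd _).
rewrite -addnn; congr (_ + _); rewrite -sum1_card big_mkcond [RHS]big_mkcond /=.
by apply: eq_bigr => z _; rewrite !inE (gs z x); case: (z == x); case: (z \in W); case: (g x z).
Qed.

Section NineVertices.
Variables (T : finType) (e : rel T).
Hypothesis e_sym : symmetric e.
Hypothesis e_irr : irreflexive e.
Implicit Types (K S W : {set T}) (x y : T).

Definition nonnbrs v W := [set y in W | (v != y) && ~~ e v y].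

Lemma drop2_intro K1 K2 W a : clq e K1 -> clq e K2 ->
  alpha_le e (W :\: K1 :\: K2) a -> drop e 2 W a.
Proof. by move=> c1 c2 aW; apply: (drop_cons c1 (drop_cons c2 (drop0 aW))). Qed.

Lemma clqU1 v K : clq e K -> (forall x, x \in K -> x != v -> e v x) -> clq e (v |: K).
Proof.
move=> /clqP cK h; apply/clqP => x y; rewrite !inE.
case/orP => [/eqP->|xK] /orP[/eqP->|yK] xy; first by rewrite eqxx in xy.
- by apply: h => //; rewrite eq_sym.
- by rewrite e_sym; apply: h.
exact: cK.
Qed.

Lemma clqS K K' : K' \subset K -> clq e K -> clq e K'.
Proof.
by move=> /subsetP s /clqP cK; apply/clqP => x y /s xK /s yK; apply: cK.
Qed.

Lemma alpha1_clq W : alpha_le e W 1 -> clq e W.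
Proof.
move=> /alpha_leP aW; apply/clqP => x y xW yW xy; apply/negPn/negP => exy.
suff /aW : stable e [set x; y] by rewrite subUset !sub1set xW yW cards2 xy => /(_ isT).
apply: stableU1 => // [z|]; last exact: stable1.
by rewrite inE => /eqP->.
Qed.

Lemma clq_alpha1 W K : clq e K -> W \subset K -> alpha_le e W 1.
Proof.
move=> cK WK; apply/alpha_leP => S sS SW.
by have := clq_stable cK sS; rewrite (setIidPr (subset_trans SW WK)).
Qed.

Lemma nonnbrs_clq v W : v \in W -> alpha_le e W 2 -> clq e (nonnbrs v W).
Proof.
move=> vW /alpha_leP aW; apply/clqP => x y; rewrite !inE.
move=> /andP[xW /andP[vx evx]] /andP[yW /andP[vy evy]] xy; apply/negPn/negP => exy.
have sxy : stable e [set x; y].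
  apply: stableU1 => // [z|]; last exact: stable1.
  by rewrite inE => /eqP->.
suff /aW : stable e (v |: [set x; y]).
  by rewrite !subUset !sub1set vW xW yW cardsU1 cards2 !inE negb_or vx vy xy => /(_ isT).
by apply: stableU1 => // z; rewrite !inE => /orP[]/eqP->.
Qed.

(** One of the three cliques [K1], [K2] and the rest contains none of the at most two non-neighbours
    of [v], and can take [v]. *)
Lemma drop2_add v W : drop e 2 (W :\ v) 1 -> #|nonnbrs v W| <= 2 -> drop e 2 W 1.
Proof.
case=> -[|K1 [|K2 [|? ?]]] [] //= _ /and3P[c1 c2 _] aR cN.
set R := W :\ v :\: K1 :\: K2 in aR.
have notN z : z \in W -> z \notin nonnbrs v W -> z != v -> e v z.
  by move=> zW zN zv; apply: contraNT zN => ev; rewrite inE zW ev eq_sym zv.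
have [d1|/pred0Pn[x1 /andP[/= x1N x1K]]] := boolP [disjoint nonnbrs v W & K1].
  have c1' : clq e (v |: (K1 :&: W)).
    apply: clqU1; first by apply: clqS c1; apply: subsetIl.
    move=> z; rewrite inE => /andP[zK zW]; apply: notN => //.
    by rewrite (disjointFl d1 zK).
  apply: (drop2_intro c1' c2); apply: alpha_leS aR => //; apply/subsetP => z.
  by rewrite /R !inE; case: (z == v); case: (z \in K1); case: (z \in K2); case: (z \in W).
have [d2|/pred0Pn[x2 /andP[/= x2N x2K]]] := boolP [disjoint nonnbrs v W & K2 :\: K1].
  have c2' : clq e (v |: ((K2 :\: K1) :&: W)).
    apply: clqU1; first by apply: clqS c2; apply: subset_trans (subsetIl _ _) (subsetDl _ _).
    move=> z; rewrite inE => /andP[zK zW]; apply: notN => //.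
    by rewrite (disjointFl d2 zK).
  apply: (drop2_intro c1 c2'); apply: alpha_leS aR => //; apply/subsetP => z.
  by rewrite /R !inE; case: (z == v); case: (z \in K1); case: (z \in K2); case: (z \in W).
have x12 : x1 != x2 by apply: contraTneq x1K => ->; move: x2K; rewrite inE => /andP[].
have eN : [set x1; x2] = nonnbrs v W.
  by apply/eqP; rewrite eqEcard cards2 x12 cN subUset !sub1set x1N x2N.
have cR : clq e (v |: R).
  apply: clqU1; first exact: alpha1_clq.
  move=> z zR; have /and4P[z2 z1 _ zW] : [&& z \notin K2, z \notin K1, z != v & z \in W].
    by move: zR; rewrite /R !inE.
  apply: notN => //; rewrite -eN !inE negb_or; apply/andP; split.
    by apply: contraNneq z1 => ->.
  by apply: contraNneq z2 => ->; move: x2K; rewrite inE => /andP[].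
apply: (drop2_intro c1 c2); apply: clq_alpha1 cR _; apply/subsetP => z.
by rewrite /R !inE; case: (z == v); case: (z \in K1); case: (z \in K2); case: (z \in W).
Qed.

(** A vertex with at most two non-neighbours is put back after induction. If [v] has at most four
    neighbours, these split into two cliques, one of which takes [v], and its non-neighbours form
    the third. Otherwise [1 + 5 + 3 <= 9] forces exactly three non-neighbours at each of nine
    vertices. *)
Lemma nine_vertices W : #|W| <= 9 -> alpha_le e W 2 -> drop e 2 W 1.
Proof.
have [n] := ubnP #|W|; elim: n W => // n IHn W; rewrite ltnS => cWn cW aW.
have [/exists_inP[v vW cN]|h1] := boolP [exists v in W, #|nonnbrs v W| <= 2].
  have c1 := cardsD1 v W; rewrite vW in c1.
  apply: (drop2_add (v := v)) => //; apply: IHn.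
  - by move: cWn; rewrite c1.
  - by move: cW; rewrite c1; apply: leq_trans; apply: leqW.
  by apply: alpha_leS aW => //; apply: subsetDl.
have {}h1 v : v \in W -> 2 < #|nonnbrs v W|.
  by move=> vW; rewrite ltnNge; apply: contra h1 => h; apply/exists_inP; exists v.
pose X v := W :\: nonnbrs v W :\ v.
have cX v : v \in W -> #|X v| + 1 + #|nonnbrs v W| = #|W|.
  move=> vW; rewrite -(cardsID (nonnbrs v W) W) /X.
  have /setIidPr-> : nonnbrs v W \subset W by apply/subsetP => y; rewrite inE => /andP[].
  rewrite [#|W :\: _|](cardsD1 v) in_setD vW inE eqxx andbF /=.
  by rewrite [1 + _]addnC [RHS]addnC.
have [/exists_inP[v vW cv]|h2] := boolP [exists v in W, #|X v| <= 4].
  have aX : alpha_le e (X v) 2.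
    by apply: alpha_leS aW => //; apply: subset_trans (subsetDl _ _) (subsetDl _ _).
  have [[|K [|? ?]] [] //= _ /andP[cK _] aK] := multi_drop e_sym e_irr (aX : alpha_le e (X v) (1 + 1)) cv.
  have cK' : clq e (v |: (K :&: X v)).
    apply: clqU1; first by apply: clqS cK; apply: subsetIl.
    move=> z; rewrite !inE => /andP[_ /andP[zv /andP[+ zW]]] _.
    by rewrite zW eq_sym zv /= negbK.
  apply: (drop2_intro (nonnbrs_clq vW aW) cK'); apply: alpha_leS aK => //.
  apply/subsetP => z; rewrite !inE.
  by case: (z == v); case: (z \in K); case: (z \in W); case: (v == z); case: (e v z).
have {}h2 v : v \in W -> 4 < #|X v|.
  by move=> vW; rewrite ltnNge; apply: contra h2 => h; apply/exists_inP; exists v.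
have [->|/set0Pn[u uW]] := eqVneq W set0.
  apply: (drop2_intro (clq0 e) (clq0 e)); apply/alpha_leP => S _.
  by rewrite !setD0 subset0 => /eqP->; rewrite cards0.
have c3 v : v \in W -> #|nonnbrs v W| = 3 /\ #|W| = 9.
  by move=> vW; have := cX v vW; have := h1 v vW; have := h2 v vW; move: cW; clear; card_lia.
have := @handshake T (fun x y => (x != y) && ~~ e x y) W.
have [_ cW9] := c3 u uW.
rewrite (eq_bigr (fun _ => 3)); last by move=> v /c3[].
rewrite sum_nat_const cW9 => h; exfalso; suff : ~~ odd (9 * 3) by [].
by apply: h => [x y|x]; rewrite ?eqxx // eq_sym e_sym.
Qed.
End NineVertices.

Lemma folkman_exists2 p : 1 < p -> exists (T : finType) (e : rel T), folkman 2 p e.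
Proof.
elim/ltn_ind: p => -[|[|[|[|p]]]] // IH _.
(* The circulant graph of order 13 with steps 2 and 3. *)
- have a2 : Fv_admissible (twos_p 2 2) (2 + 2 - 1) 13.
    apply: (@search_admissible [:: 2; 3; 10; 11]) => //; by vm_compute.
  by have [e fe] := admissible_folkman (isT : 0 < 2) (isT : 0 < 2) a2; exists 'I_13, e.
(* The Paley graph of order 17: the list consists of the nonzero squares modulo 17. *)
- have a3 : Fv_admissible (twos_p 2 3) (2 + 3 - 1) 17.
    apply: (@search_admissible [:: 1; 2; 4; 8; 9; 13; 15; 16]) => //; by vm_compute.
  by have [e fe] := admissible_folkman (isT : 0 < 2) (isT : 0 < 3) a3; exists 'I_17, e.
have [T1 [e1 f1]] := IH p.+2 (ltnW (ltnSn _)) isT.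
have [T2 [e2 f2]] := IH 2 isT isT.
by exists (T1 + T2)%type; eexists; rewrite -[p.+4](addn2 p.+2); apply: (folkman_union _ _ f1 f2).
Qed.

Lemma folkman_exists r p : 1 < r -> 1 < p ->
  exists (T : finType) (e : rel T), folkman r p e.
Proof.
move=> + p1; elim: r => [|[|[|r]] IHr] // _; first exact: folkman_exists2.
have [T [e fe]] := IHr isT.
by exists (option T); eexists; apply: (folkman_isolated p1 fe).
Qed.

(** * The recursion for the Folkman numbers *)

Section Numbers.
Variable p : nat.
Hypothesis p1 : 1 < p.

Let F r := Fv (twos_p r p) (r + p - 1).

Lemma F_folkman r : 1 < r -> exists e : rel 'I_(F r), folkman r p e.
Proof.
move=> r1; have [T [e fe]] := folkman_exists r1 p1.
have ex : exists n, Fv_admissible (twos_p r p) (r + p - 1) n.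
  by exists #|T|; apply: folkman_admissible fe; apply: ltnW.
by have [aF _] := Fv_spec ex; apply: admissible_folkman aF; apply: ltnW.
Qed.

Lemma F_le r (T : finType) (e : rel T) : 1 < r -> folkman r p e -> F r <= #|T|.
Proof.
move=> r1 fe; have aT := folkman_admissible (ltnW r1) (ltnW p1) fe.
by have [_ h] := Fv_spec (ex_intro _ _ aT); apply: h.
Qed.

Lemma F_step r : 1 < r -> F r.+1 <= (F r).+1.
Proof.
move=> r1; have [e fe] := F_folkman r1.
have := F_le (ltnW r1 : 1 < r.+1) (folkman_isolated p1 fe).
by rewrite card_option card_ord.
Qed.

(** [K] spends one of the [r.+1] cliques, so what it leaves is a witness for [r]. *)
Lemma folkman_remove (T : finType) (e : rel T) r K : 1 < r -> folkman r.+1 p e ->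
  clq e K -> alpha_le e (setT :\: K) (r + p - 2) -> F r <= #|T| - #|K|.
Proof.
move=> r1 [e_sym e_irr aT nD] cK aK; pose W := setT :\: K.
pose e' (x y : {x | x \in W}) := e (val x) (val y).
have cW : #|T| - #|K| = #|{: {x | x \in W}}|.
  have -> : #|T| - #|K| = #|W| by rewrite /W cardsD setTI cardsT.
  by rewrite card_sig; apply: eq_card.
rewrite cW; apply: (@F_le r _ e') => //; split.
- by move=> x y; apply: e_sym.
- by move=> x; apply: e_irr.
- have := alpha_le_preimset val_inj (fun x y => erefl : e (val x) (val y) = e' x y) aK.
  by apply: alpha_leS => //; apply/subsetP => x _; rewrite inE (valP x).
by move=> d; apply: nD; apply: (drop_cons cK); apply: drop_sub_type d.
Qed.

Lemma F2_small : F 2 <= 2 * p + 5 -> 2 < p.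
Proof.
move: p1; rewrite leq_eqVlt => /orP[/eqP p2|//].
have [e [e_sym e_irr aT nD]] := F_folkman (isT : 1 < 2).
rewrite -p2 => h; case: nD; rewrite -p2.
by apply: nine_vertices => //; rewrite ?cardsT ?card_ord // -p2 in aT *.
Qed.

Lemma F_eq r : F 2 <= 2 * p + 5 -> 1 < r -> F r = F 2 + r - 2.
Proof.
move=> F2; have p2 := F2_small F2.
elim: r => [|[|[|r]] IHr] // _; first by rewrite addnK.
have {}IHr := IHr isT; set s := r.+2 in IHr *.
have s1 : 1 < s by [].
have up := F_step s1.
suff lo : F s < F s.+1.
  apply/eqP; rewrite eqn_leq; move: up lo; rewrite IHr /s; clear; card_lia.
rewrite ltnNge; apply/negP => lo.
have [e fe] := F_folkman (ltnW s1 : 1 < s.+1).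
have [e_sym e_irr aT nD] := fe.
(* A nonempty clique against robustness would leave a witness for [s] on fewer than [F s.+1 <= F s]
   vertices; an empty one is replaced by a single vertex. *)
have rob : robust e setT (p.-1 + r).+1.
  move=> K cK _; apply/negP => aK.
  have rem K' : clq e K' -> K' != set0 -> alpha_le e (setT :\: K') (s + p - 2) -> False.
    move=> cK' K0 aK'; have := folkman_remove s1 fe cK' aK'.
    have := subset_leq_card (subsetT K'); rewrite cardsT card_ord; move: K0; rewrite -card_gt0.
    by move: lo; clear; card_lia.
  have eq_a : (p.-1 + r).+1 = s + p - 2 by move: p2; rewrite /s; clear; lia.
  rewrite eq_a in aK.
  have [K0|K0] := eqVneq K set0; last exact: rem cK K0 aK.
  have [x _|noT] := pickP (fun x : 'I_(F s.+1) => true).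
    apply: (rem [set x]); rewrite ?clq1 //.
      by apply/set0Pn; exists x; rewrite inE.
    by rewrite K0 setD0 in aK; apply: alpha_leS aK => //; apply: subsetT.
  apply: nD; exists (nseq s.+1 set0); split; rewrite ?size_nseq //.
    by apply/allP => K' /nseqP[-> _]; apply: clq0.
  apply/alpha_leP => S _ _; rewrite (_ : S = set0) ?cards0 //.
  by apply/setP => x; have := noT x.
(* The origin of [2p + 5]: the bound [2(p - 1) + r + 7] is [2p + 5 + r], which is at least
   [F 2 + r = F s]. *)
have := @robust_card_bound _ e p.-1 r e_sym e_irr; rewrite card_ord => h.
have : p.-1.*2 + r + 7 < F s.+1.
  apply: h => //; first by move: p2; clear; lia.
  by apply: alpha_leS aT => //; move: p2; rewrite /s; clear; lia.
by move: lo F2; rewrite IHr /s; move: p2; clear; card_lia.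
Qed.
End Numbers.

Theorem theorem3p12 (p : nat) :
  2 <= p ->
  Fv (twos_p 2 p) p.+1 <= 2 * p + 5 ->
  rprime p = 2 /\
  (forall r : nat, 2 <= r ->
     Fv (twos_p r p) (r + p - 1) = Fv (twos_p 2 p) p.+1 + r - 2).
Proof.
move=> p2 F2.
have e2 : 2 + p - 1 = p.+1 by rewrite -addn1 addnC; lia.
have main r : 2 <= r -> Fv (twos_p r p) (r + p - 1) = Fv (twos_p 2 p) p.+1 + r - 2.
  by move=> r2; rewrite -e2; apply: F_eq => //; rewrite e2.
split=> //.
(* All the differences coincide, so the least minimiser is the least value allowed. *)
have val r : 2 <= r -> rp_val p r = rp_val p 2.
  move=> r2; rewrite /rp_val main // [in RHS]main //.
  move: (Fv _ _) => f; lia.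
have [r0 h1 h2] : [/\ 2 <= rprime p,
    (forall r, 2 <= r -> (rp_val p (rprime p) <= rp_val p r)%R) &
    (forall r, 2 <= r -> r < rprime p -> (rp_val p (rprime p) < rp_val p r)%R)].
  apply: (epsilon_spec (inhabits 0) (fun r0 => [/\ 2 <= r0,
    (forall r, 2 <= r -> (rp_val p r0 <= rp_val p r)%R) &
    (forall r, 2 <= r -> r < r0 -> (rp_val p r0 < rp_val p r)%R)])).
  exists 2; split=> // [r r2|r r2 /(leq_trans r2)]; last by rewrite ltnn.
  by rewrite (val r r2) Order.POrderTheory.lexx.
apply/eqP; rewrite eqn_leq r0 andbT leqNgt; apply/negP => lt.
by have := h2 2 isT lt; rewrite (val _ r0) Order.POrderTheory.ltxx.
Qed.
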